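(* Let $X$ be a Banach space with the uniform primary factorisation property (UPFP). Suppose that at least one of the following holds: (i) $X$ is isomorphic to $\ell_p(X)$ for some $1\le p\le\infty$, or $X$ is isomorphic to $c_0(X)$; (ii) the dual space $X^*$ has finite cotype. Then $\ell_1(X)$ has the UPFP. In particular, $\ell_1(X)$ is primary.
   Context: The scalar field is $\mathbb{R}$ or $\mathbb{C}$; operators are bounded linear maps; isomorphic means linearly homeomorphic. For a Banach space $X$, $\ell_p(X)$ ($1\le p\le\infty$) and $c_0(X)$ are the spaces of sequences $(x_n)_{n\in\mathbb{N}}$ in $X$ with $(\|x_n\|)_n\in\ell_p$, respectively $(\|x_n\|)_n\in c_0$, normed by $\|(\|x_n\|)_n\|_{\ell_p}$, respectively $\sup_n\|x_n\|$. For $C\ge1$, an operator $S\colon Z\to W$ factors through an operator $T\colon X\to Y$ with constant $C$ if there are operators $V\colon Z\to X$, $U\colon Y\to W$ with $UTV=S$ and $\|U\|\|V\|\le C$. A Banach space $X$ has the $C$-primary factorisation property ($C$-PFP) if for every operator $T\colon X\to X$ the identity $I_X$ factors through either $T$ or $I_X-T$ with constant $C$; $X$ has the uniform primary factorisation property (UPFP) if it has the $C$-PFP for some $C\ge1$. $X$ is primary if for every bounded projection $P\colon X\to X$ at least one of $PX$ and $(I_X-P)X$ is isomorphic to $X$. Finite cotype means cotype $q$ for some $q<\infty$. *)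

(* Defs.v *)
From HB Require Import structures.
From mathcomp Require Import all_boot all_order all_algebra.
From mathcomp Require Import complex finmap.
From mathcomp Require Import all_classical all_reals all_analysis.
From mathcomp Require Import ess_sup_inf.

Set Implicit Arguments.
Unset Strict Implicit.
Unset Printing Implicit Defensive.

Import Order.TTheory GRing.Theory Num.Theory.
Import numFieldNormedType.Exports.

Local Open Scope classical_set_scope.
Local Open Scope ring_scope.

Variant scalars := RealScalars | ComplexScalars.

Definition scalar_field (R : realType) (s : scalars) : numFieldType :=
  match s with
  | RealScalars => R
  | ComplexScalars => R[i]
  end.

Definition of_real (R : realType) (s : scalars) : R -> scalar_field R s :=
  match s with
  | RealScalars => id
  | ComplexScalars => real_complex R
  end.

Definition real_part (R : realType) (s : scalars) : scalar_field R s -> R :=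
  match s with
  | RealScalars => id
  | ComplexScalars => @complex.Re R
  end.

(* In a [normedModType K] the norm takes its values in [K]; for complex scalars
   these are nonnegative reals seen in [R[i]] (lemma [of_real_rnorm]). *)
Definition rnorm (R : realType) (s : scalars)
    (X : normedModType (scalar_field R s)) (x : X) : R :=
  real_part `|x|.

Definition rabs (R : realType) (s : scalars) (a : scalar_field R s) : R :=
  real_part `|a|.

Section scalar_lemmas.
Context (R : realType) (s : scalars).
Local Notation K := (scalar_field R s).
Implicit Types a b : R.

Lemma of_real0 : of_real s 0 = 0 :> K.
Proof. by case: s. Qed.

Lemma of_realD a b : of_real s (a + b) = of_real s a + of_real s b.
Proof. by case: s => //=; rewrite rmorphD. Qed.

Lemma of_realM a b : of_real s (a * b) = of_real s a * of_real s b.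
Proof. by case: s => //=; rewrite rmorphM. Qed.

Lemma ler_of_real a b : (of_real s a <= of_real s b) = (a <= b).
Proof. by case: s => //=; rewrite lecR. Qed.

Lemma of_real_inj : injective (of_real s : R -> K).
Proof. by move=> a b ab; apply/eqP; rewrite eq_le -!ler_of_real ab lexx. Qed.

Lemma real_partK (x : K) : 0 <= x -> of_real s (real_part x) = x.
Proof.
case: s x => //= -[x y]; rewrite lecE /= => /andP[/eqP y0 _].
by rewrite /real_complex_def y0.
Qed.

Lemma of_realK a : real_part (of_real s a) = a.
Proof. by case: s. Qed.

Lemma of_real_rnorm (X : normedModType K) (x : X) :
  of_real s (rnorm x) = `|x|.
Proof. exact: real_partK. Qed.

Lemma of_real_rabs (x : K) : of_real s (rabs x) = `|x|.
Proof. exact: real_partK. Qed.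

Lemma rabs_ge0 (x : K) : 0 <= rabs x.
Proof. by rewrite -(ler_of_real 0) of_real0 of_real_rabs. Qed.

Section rnorm_lemmas.
Variable X : normedModType K.
Implicit Types x y : X.

Lemma rnorm_ge0 x : 0 <= rnorm x.
Proof. by rewrite -(ler_of_real 0) of_real0 of_real_rnorm. Qed.

Lemma rnorm0 : rnorm (0 : X) = 0.
Proof. by apply: of_real_inj; rewrite of_real_rnorm of_real0 normr0. Qed.

Lemma rnorm0_eq0 x : rnorm x = 0 -> x = 0.
Proof.
by move=> x0; apply/normr0_eq0; rewrite -of_real_rnorm x0 of_real0.
Qed.

Lemma ler_rnormD x y : rnorm (x + y) <= rnorm x + rnorm y.
Proof. by rewrite -ler_of_real of_realD !of_real_rnorm ler_normD. Qed.

Lemma rnormZ (a : K) x : rnorm (a *: x) = rabs a * rnorm x.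
Proof.
by apply: of_real_inj; rewrite of_realM of_real_rabs !of_real_rnorm normrZ.
Qed.

End rnorm_lemmas.
End scalar_lemmas.

(* A linear subspace [ns_set] of a vector space [L], with a norm on it; the
   values of [ns_norm] outside of [ns_set] are irrelevant. *)
Record normed_subspace (R : realType) (s : scalars)
    (L : lmodType (scalar_field R s)) := NormedSubspace {
  ns_set : set L;
  ns_norm : L -> R;
  ns_set0 : ns_set 0;
  ns_setP : forall a x y, ns_set x -> ns_set y -> ns_set (a *: x + y);
  ns_normD : forall x y, ns_set x -> ns_set y ->
    ns_norm (x + y) <= ns_norm x + ns_norm y;
  ns_normZ : forall a x, ns_set x -> ns_norm (a *: x) = rabs a * ns_norm x;
  ns_norm0 : forall x, ns_set x -> ns_norm x = 0 -> x = 0;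
}.

Section nspace.
Context (R : realType) (s : scalars) (L : lmodType (scalar_field R s)).
Variable E : normed_subspace L.
Local Notation K := (scalar_field R s).

Definition ns_pred : {pred L} := fun x => `[< ns_set E x >].

Record nspace : Type := NSpace { ns_val : L; ns_valP : ns_val \in ns_pred }.

HB.instance Definition _ := [isSub for ns_val].
HB.instance Definition _ := [Choice of nspace by <:].

Lemma ns_pred_submod_closed : submod_closed ns_pred.
Proof.
split; first exact/asboolP/ns_set0.
by move=> a x y /asboolP xE /asboolP yE; exact/asboolP/ns_setP.
Qed.

HB.instance Definition _ := GRing.isSubmodClosed.Build _ _ ns_pred
  ns_pred_submod_closed.
HB.instance Definition _ := [SubChoice_isSubLmodule of nspace by <:].

Lemma ns_valE (x : nspace) : ns_set E (ns_val x).
Proof. exact/asboolP/(ns_valP x). Qed.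

Let norm (x : nspace) : K := of_real s (ns_norm E (ns_val x)).

Let norm_triangle x y : norm (x + y) <= norm x + norm y.
Proof. by rewrite /norm -of_realD ler_of_real ns_normD//; exact: ns_valE. Qed.

Let normZ a x : norm (a *: x) = `|a| * norm x.
Proof.
by rewrite /norm -of_real_rabs -of_realM -ns_normZ//; exact: ns_valE.
Qed.

Let norm0_eq0 x : norm x = 0 -> x = 0.
Proof.
rewrite /norm -(of_real0 _ s) => /of_real_inj x0.
by apply: val_inj; exact: ns_norm0 (ns_valE x) x0.
Qed.

HB.instance Definition _ := Lmodule_isNormed.Build K nspace
  norm_triangle normZ norm0_eq0.

Lemma rnorm_nspace (x : nspace) : rnorm x = ns_norm E (ns_val x).
Proof. exact: of_realK. Qed.

End nspace.

Section operators.
Context (R : realType) (s : scalars).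
Local Notation K := (scalar_field R s).

Definition is_operator (X Y : normedModType K) (f : X -> Y) : Prop :=
  linear f /\ exists M : R, forall x, rnorm (f x) <= M * rnorm x.

Definition opnorm (X Y : normedModType K) (f : X -> Y) : R :=
  sup [set rnorm (f x) | x in [set x | rnorm x <= 1]].

Section operator_space.
Variables X Y : normedModType K.
Implicit Types f g : X -> Y.

Let is_operator0 : is_operator (0 : X -> Y).
Proof.
split=> [a x y|]; first by rewrite /= scaler0 addr0.
by exists 0 => x; rewrite mul0r rnorm0.
Qed.

Let is_operatorP a f g :
  is_operator f -> is_operator g -> is_operator (a *: f + g).
Proof.
move=> [lf [M fM]] [lg [N gN]]; split=> [b x y|].
  rewrite !fctE lf lg !scalerDr addrACA; congr (_ + _ + _).
  by rewrite !scalerA mulrC.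
exists (rabs a * M + N) => x; rewrite fctE /=.
rewrite (le_trans (ler_rnormD _ _))// mulrDl lerD//.
by rewrite [X in rnorm X]/(a *: f x) rnormZ -mulrA ler_wpM2l ?rabs_ge0.
Qed.

Let ball_image f := [set rnorm (f x) | x in [set x | rnorm x <= 1]].

Let has_sup_ball f : is_operator f -> has_sup (ball_image f).
Proof.
move=> [_ [M fM]]; split; first by exists (rnorm (f 0)), 0; rewrite //= rnorm0.
exists `|M| => _ [x /= x1 <-]; rewrite (le_trans (fM x))//.
rewrite (le_trans (ler_wpM2r (rnorm_ge0 _) (ler_norm M)))//.
by rewrite ler_piMr.
Qed.

Lemma ler_opnorm f x : is_operator f -> rnorm (f x) <= opnorm f * rnorm x.
Proof.
move=> fP; have [lf _] := fP.
have f0 : f 0 = 0 by have := lf (-1) 0 0; rewrite !scaleN1r addNr addNr.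
have [x0|x_neq0] := eqVneq (rnorm x) 0.
  by rewrite (rnorm0_eq0 x0) f0 !rnorm0 mulr0.
have x_gt0 : 0 < rnorm x by rewrite lt_neqAle eq_sym x_neq0 rnorm_ge0.
have cE : rabs (of_real s (rnorm x)^-1) = (rnorm x)^-1.
  apply: (@of_real_inj _ s); rewrite of_real_rabs ger0_norm//.
  by rewrite -(of_real0 _ s) ler_of_real invr_ge0 ltW.
rewrite -ler_pdivrMr// mulrC -cE -rnormZ.
have -> : of_real s (rnorm x)^-1 *: f x = f (of_real s (rnorm x)^-1 *: x).
  by have := lf (of_real s (rnorm x)^-1) x 0; rewrite f0 !addr0.
apply: sup_upper_bound; first exact: has_sup_ball.
by eexists; [|reflexivity]; rewrite /= rnormZ cE mulVf.
Qed.

Let opnormD f g : is_operator f -> is_operator g ->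
  opnorm (f + g) <= opnorm f + opnorm g.
Proof.
move=> fP gP; have fgP : is_operator (f + g).
  by rewrite -[f]scale1r; exact: is_operatorP.
apply: ge_sup; first exact: (has_sup_ball fgP).1.
move=> _ [x x1 <-]; rewrite (le_trans (ler_rnormD _ _))// lerD//.
  by apply: sup_upper_bound; [exact: has_sup_ball|exists x].
by apply: sup_upper_bound; [exact: has_sup_ball|exists x].
Qed.

Let opnormZ a f : is_operator f -> opnorm (a *: f) = rabs a * opnorm f.
Proof.
move=> fP; have afP : is_operator (a *: f).
  by rewrite -[_ *: _]addr0; exact: is_operatorP.
have le_opnormZ b g : is_operator g -> opnorm (b *: g) <= rabs b * opnorm g.
  move=> gP; apply: ge_sup; first by exists (rnorm (b *: g 0)), 0; rewrite //= rnorm0.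
  move=> _ [x x1 <-]; rewrite [X in rnorm X]/(b *: g x) rnormZ.
  rewrite ler_wpM2l ?rabs_ge0//.
  by apply: sup_upper_bound; [exact: has_sup_ball|exists x].
have r0 : rabs (0 : K) = 0.
  by apply: (@of_real_inj _ s); rewrite of_real_rabs of_real0 normr0.
have opn_ge0 g : is_operator g -> 0 <= opnorm g.
  move=> gP; apply: le_trans (rnorm_ge0 (g 0)) _.
  by apply: sup_upper_bound; [exact: has_sup_ball|exists 0; rewrite //= rnorm0].
apply/eqP; rewrite eq_le le_opnormZ//=.
have [->|a0] := eqVneq a 0; first by rewrite r0 mul0r scale0r opn_ge0.
have ar : rabs a != 0.
  apply: contra a0 => /eqP a0; rewrite -normr_eq0 -of_real_rabs a0.
  by rewrite of_real0.
have := le_opnormZ a^-1 _ afP; rewrite scalerA mulVf// scale1r.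
have -> : rabs a^-1 = (rabs a)^-1.
  apply: (mulfI ar); rewrite mulfV//; apply: (@of_real_inj _ s).
  rewrite of_realM !of_real_rabs -normrM mulfV// normr1.
  by case: s.
by rewrite ler_pdivlMl// lt_neqAle eq_sym ar rabs_ge0.
Qed.

Let opnorm0_eq0 f : is_operator f -> opnorm f = 0 -> f = 0.
Proof.
move=> fP f0; apply/funext => x; apply/rnorm0_eq0/eqP.
by rewrite eq_le rnorm_ge0 andbT (le_trans (ler_opnorm _ fP))// f0 mul0r.
Qed.

Definition operator_ns : normed_subspace (X -> Y) :=
  NormedSubspace is_operator0 is_operatorP opnormD opnormZ opnorm0_eq0.

End operator_space.

Definition operator (X Y : normedModType K) : Type := nspace (operator_ns X Y).

HB.instance Definition _ (X Y : normedModType K) :=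
  NormedModule.copy (operator X Y) (nspace (operator_ns X Y)).

Definition op_fun (X Y : normedModType K) (T : operator X Y) : X -> Y :=
  ns_val T.

Coercion op_fun : operator >-> Funclass.

Lemma operatorP (X Y : normedModType K) (T : operator X Y) : is_operator T.
Proof. exact: (ns_valE T). Qed.

Lemma rnorm_operator (X Y : normedModType K) (T : operator X Y) :
  rnorm T = opnorm T.
Proof. exact: rnorm_nspace. Qed.

End operators.

Section sequence_spaces.
Context (R : realType) (s : scalars).
Local Notation K := (scalar_field R s).
Variable X : normedModType K.
Implicit Types (x y : nat -> X) (p : \bar R).

(* The L^p norm, 1 <= p <= +oo, of the sequence of norms for the counting
   measure on nat; see [lp_normE] and [lp_normyE] for explicit formulas. *)
Definition lp_norm p x : \bar R :=
  'N[@counting nat R]_p[EFin \o (fun n => rnorm (x n))]%E.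

Lemma lp_norm_ge0 p x : (0 <= lp_norm p x)%E.
Proof. exact: Lnorm_ge0. Qed.

Lemma lp_normE (r : R) x : 0 < r ->
  lp_norm r%:E x = ((\sum_(n <oo) (rnorm (x n) `^ r)%:E) `^ r^-1)%E.
Proof.
move=> r0; rewrite /lp_norm Lnorm_counting//; congr (_ `^ _)%E.
by apply: eq_eseriesr => n _ /=; rewrite ger0_norm ?rnorm_ge0.
Qed.

Lemma lp_normyE x : lp_norm +oo x = ereal_sup (range (fun n => (rnorm (x n))%:E)).
Proof.
have ae_all (P : nat -> Prop) : (\forall n \ae @counting nat R, P n) ->
    forall n, P n.
  move=> [A [_ A0 PA]] n; apply: contrapT => /PA An; move: A0.
  rewrite /counting; case: asboolP => [fA|//] /eqP.
  rewrite eqe pnatr_eq0 cardfs_eq0 => /eqP fA0.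
  by move: An; rewrite -(fset_setK fA) fA0.
have cT : (0 < @counting nat R [set: nat])%E.
  by rewrite /counting asboolF//; exact: infinite_nat.
rewrite /lp_norm unlock /Lnorm cT.
apply/eqP; rewrite eq_le; apply/andP; split.
  apply/ess_supP/nearW => n /=; rewrite ger0_norm ?rnorm_ge0//.
  by apply: ereal_sup_ubound; exists n.
apply: ge_ereal_sup => _ [n _ <-].
have /ae_all/(_ n)/= := @ess_sup_ge _ _ _ (@counting nat R)
  (abse \o (EFin \o (fun n => rnorm (x n)))).
by rewrite ger0_norm ?rnorm_ge0.
Qed.

Section lp_norm_properties.
Variables (p : \bar R) (p1 : (1 <= p)%E).

Lemma lp_normD x y : (lp_norm p (x + y)%R <= lp_norm p x + lp_norm p y)%E.
Proof.
apply: le_trans (eminkowski _ _ _ p1) => //.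
have le_lp (f g : nat -> R) : (forall n, 0 <= f n <= g n) ->
    ('N[@counting nat R]_p[EFin \o f] <= 'N[@counting nat R]_p[EFin \o g])%E.
  move=> fg; rewrite unlock /Lnorm; case: p p1 => [r r1||//].
    rewrite lee_fin in r1.
    apply: gt0_ler_poweR.
    - by rewrite invr_ge0 (le_trans ler01).
    - by rewrite in_itv/= leey andbT integral_ge0.
    - by rewrite in_itv/= leey andbT integral_ge0.
    apply: ge0_le_integral => // n _.
      by rewrite lee_fin powR_ge0.
    have /andP[f0 fgn] := fg n.
    rewrite /= lee_fin; apply: ge0_ler_powR; rewrite ?nnegrE//.
      exact: le_trans r1.
    by rewrite !ger0_norm// (le_trans f0).
  move=> _; case: ifP => // _; apply: le_ess_sup; apply: nearW => n /=.
  have /andP[f0 fgn] := fg n.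
  by rewrite lee_fin !ger0_norm// (le_trans f0).
by apply: le_lp => n; rewrite rnorm_ge0 /= ler_rnormD.
Qed.

Lemma lp_normZ (a : K) x : lp_norm p (a *: x) = ((rabs a)%:E * lp_norm p x)%E.
Proof.
case: p p1 => [r|_|//].
  rewrite lee_fin => r1; have r0 : 0 < r by rewrite (lt_le_trans ltr01).
  rewrite !lp_normE//.
  rewrite (eq_eseriesr (g := fun n => ((rabs a `^ r)%:E * (rnorm (x n) `^ r)%:E)%E)).
    rewrite nneseriesZl; last by move=> n _; rewrite lee_fin powR_ge0.
    rewrite poweRM ?lee_fin ?powR_ge0//; last first.
      by apply: nneseries_ge0 => n _ _; rewrite lee_fin powR_ge0.
    by rewrite poweR_EFin -powRrM mulfV ?gt_eqF// powRr1// rabs_ge0.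
  move=> n _; rewrite [X in rnorm X]/(a *: x n) rnormZ.
  by rewrite powRM ?rabs_ge0 ?rnorm_ge0// EFinM.
rewrite !lp_normyE -ereal_supZl ?rabs_ge0//; last first.
  by apply/set0P; exists (rnorm (x 0%N))%:E, 0%N.
congr ereal_sup; apply/seteqP; split => [_ [n _ <-]|_ [_ [n _ <-] <-]].
  by eexists; [exists n|rewrite [X in rnorm X]/(a *: x n) rnormZ].
by exists n => //; rewrite [X in rnorm X]/(a *: x n) rnormZ.
Qed.

Lemma le_lp_norm x n : ((rnorm (x n))%:E <= lp_norm p x)%E.
Proof.
case: p p1 => [r|_|//]; last first.
  by rewrite lp_normyE; apply: ereal_sup_ubound; exists n.
rewrite lee_fin => r1; have r0 : 0 < r by rewrite (lt_le_trans ltr01).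
rewrite lp_normE//.
have -> : (rnorm (x n))%:E = ((rnorm (x n) `^ r)%:E `^ r^-1)%E.
  by rewrite poweR_EFin -powRrM mulfV ?gt_eqF// powRr1 ?rnorm_ge0.
apply: gt0_ler_poweR.
- by rewrite invr_ge0 ltW.
- by rewrite in_itv/= leey andbT lee_fin powR_ge0.
- by rewrite in_itv/= leey andbT nneseries_ge0// => k _ _; rewrite lee_fin powR_ge0.
apply: le_trans (nneseries_lim_ge n.+1 _) => /=.
  rewrite big_nat_recr//= leeDr// sume_ge0// => k _.
  by rewrite lee_fin powR_ge0.
by move=> k _ _; rewrite lee_fin powR_ge0.
Qed.

Lemma lp_norm_fin_num x : (lp_norm p x < +oo)%E -> lp_norm p x \is a fin_num.
Proof. by move=> ?; rewrite ge0_fin_numE// lp_norm_ge0. Qed.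

Lemma lp_norm0 : lp_norm p 0 = 0%E.
Proof.
rewrite /lp_norm (_ : EFin \o _ = cst 0%E) ?Lnorm0//.
  by rewrite gt_eqF// (lt_le_trans _ p1).
by apply/funext => n /=; rewrite rnorm0.
Qed.

Let ell_set : set (nat -> X) := [set x | (lp_norm p x < +oo)%E].
Let ell_norm x : R := fine (lp_norm p x).

Let ell_set0 : ell_set 0.
Proof. by rewrite /ell_set/= lp_norm0. Qed.

Let ell_setP (a : K) x y : ell_set x -> ell_set y -> ell_set (a *: x + y).
Proof.
move=> xp yp; apply: le_lt_trans (lp_normD _ _) _.
by rewrite lp_normZ lte_add_pinfty// lte_mul_pinfty ?lee_fin ?rabs_ge0.
Qed.

Let ell_normD x y : ell_set x -> ell_set y ->
  ell_norm (x + y) <= ell_norm x + ell_norm y.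
Proof.
move=> xp yp; rewrite /ell_norm -fineD ?lp_norm_fin_num//.
apply: fine_le (lp_normD x y); last by rewrite fin_numD !lp_norm_fin_num.
by apply: lp_norm_fin_num; rewrite (le_lt_trans (lp_normD _ _))// lte_add_pinfty.
Qed.

Let ell_normZ (a : K) x : ell_set x -> ell_norm (a *: x) = rabs a * ell_norm x.
Proof. by move=> xp; rewrite /ell_norm lp_normZ fineM// lp_norm_fin_num. Qed.

Let ell_norm0 x : ell_set x -> ell_norm x = 0 -> x = 0.
Proof.
move=> xp x0; apply/funext => n; apply/rnorm0_eq0/eqP.
rewrite eq_le rnorm_ge0 andbT -lee_fin (le_trans (le_lp_norm x n))//.
by rewrite -(fineK (lp_norm_fin_num xp)) lee_fin -/(ell_norm x) x0.
Qed.

Definition ell_ns : normed_subspace (nat -> X) :=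
  NormedSubspace ell_set0 ell_setP ell_normD ell_normZ ell_norm0.

Definition ell : Type := nspace ell_ns.

HB.instance Definition _ := NormedModule.copy ell (nspace ell_ns).

Lemma rnorm_ell (x : ell) : rnorm x = fine (lp_norm p (ns_val x)).
Proof. exact: rnorm_nspace. Qed.

End lp_norm_properties.

Let c0_set : set (nat -> X) := [set x | (fun n => rnorm (x n)) @ \oo --> (0 : R)].
Let c0_norm x : R := fine (lp_norm +oo x).

Let c0_fin x : c0_set x -> (lp_norm +oo x < +oo)%E.
Proof.
move=> x0; rewrite lp_normyE.
have [M [_ xM]] := cvg_seq_bounded (cvgP _ x0).
rewrite (@le_lt_trans _ _ (M + 1)%:E) ?ltry//.
apply: ge_ereal_sup => _ [n _ <-]; rewrite lee_fin.
by rewrite (le_trans (ler_norm _))// xM// ltrDl.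
Qed.

Let c0_set0 : c0_set 0.
Proof. by rewrite /c0_set/=; under eq_fun do rewrite rnorm0; exact: cvg_cst. Qed.

Let c0_setP (a : K) x y : c0_set x -> c0_set y -> c0_set (a *: x + y).
Proof.
move=> x0 y0; rewrite /c0_set/=.
have h : (fun n => rabs a * rnorm (x n) + rnorm (y n)) @ \oo --> (0 : R).
  rewrite -[0](addr0 (0 : R)) -[X in X + _](mulr0 (rabs a)).
  by apply: cvgD => //; exact: cvgMr.
apply: (squeeze_cvgr _ (cvg_cst 0) h); apply: nearW => n.
rewrite rnorm_ge0 /= (le_trans (ler_rnormD _ _))//.
by rewrite [X in rnorm X]/(a *: x n) rnormZ.
Qed.

Let c0_normD x y : c0_set x -> c0_set y -> c0_norm (x + y) <= c0_norm x + c0_norm y.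
Proof. by move=> /c0_fin xp /c0_fin yp; exact: (ns_normD (n := ell_ns (leey 1)) xp yp). Qed.

Let c0_normZ (a : K) x : c0_set x -> c0_norm (a *: x) = rabs a * c0_norm x.
Proof. by move=> /c0_fin xp; exact: (ns_normZ (n := ell_ns (leey 1)) a xp). Qed.

Let c0_norm0 x : c0_set x -> c0_norm x = 0 -> x = 0.
Proof. by move=> /c0_fin xp; exact: (ns_norm0 (n := ell_ns (leey 1)) xp). Qed.

Definition c0_ns : normed_subspace (nat -> X) :=
  NormedSubspace c0_set0 c0_setP c0_normD c0_normZ c0_norm0.

Definition c0 : Type := nspace c0_ns.

HB.instance Definition _ := NormedModule.copy c0 (nspace c0_ns).

Lemma rnorm_c0 (x : c0) :
  rnorm x = fine (ereal_sup (range (fun n => (rnorm (ns_val x n))%:E))).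
Proof. by rewrite [LHS]rnorm_nspace -lp_normyE. Qed.

End sequence_spaces.

Section factorisation.
Context (R : realType) (s : scalars).
Local Notation K := (scalar_field R s).

Lemma is_operator_id (X : normedModType K) : is_operator (@id X).
Proof. by split=> //; exists 1 => x; rewrite mul1r. Qed.

Definition id_op (X : normedModType K) : operator X X :=
  NSpace (asboolT (is_operator_id X) : _ \in ns_pred (operator_ns X X)).

Definition factors_through (C : R) (Z W X Y : normedModType K)
    (S : operator Z W) (T : operator X Y) : Prop :=
  exists (V : operator Z X) (U : operator Y W),
    U \o T \o V =1 S /\ rnorm U * rnorm V <= C.

Definition PFP (C : R) (X : normedModType K) : Prop :=
  forall T : operator X X,
    factors_through C (id_op X) T \/ factors_through C (id_op X) (id_op X - T).

Definition UPFP (X : normedModType K) : Prop :=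
  exists2 C : R, 1 <= C & PFP C X.

Definition isomorphic (X Y : normedModType K) : Prop :=
  exists (T : operator X Y) (S : operator Y X), cancel T S /\ cancel S T.

Section operator_range.
Variables (X Y : normedModType K) (T : operator X Y).

Let range0 : range T 0.
Proof.
exists 0 => //; have [lT _] := operatorP T.
by have := lT (-1) 0 0; rewrite !scaleN1r !addNr.
Qed.

Let rangeP (a : K) x y : range T x -> range T y -> range T (a *: x + y).
Proof.
have [lT _] := operatorP T.
by move=> [u _ <-] [v _ <-]; exists (a *: u + v); rewrite ?lT.
Qed.

Let rangeD x y : range T x -> range T y -> rnorm (x + y) <= rnorm x + rnorm y.
Proof. by move=> _ _; exact: ler_rnormD. Qed.

Let rangeZ (a : K) x : range T x -> rnorm (a *: x) = rabs a * rnorm x.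
Proof. by move=> _; exact: rnormZ. Qed.

Let range_eq0 x : range T x -> rnorm x = 0 -> x = 0.
Proof. by move=> _; exact: rnorm0_eq0. Qed.

Definition op_range_ns : normed_subspace Y :=
  NormedSubspace range0 rangeP rangeD rangeZ range_eq0.

Definition op_range : Type := nspace op_range_ns.

HB.instance Definition _ := NormedModule.copy op_range (nspace op_range_ns).

End operator_range.

Definition primary (X : normedModType K) : Prop :=
  forall P : operator X X, P \o P =1 P ->
    isomorphic (op_range P) X \/ isomorphic (op_range (id_op X - P)) X.

Definition dual (X : normedModType K) : Type := operator X K^o.

HB.instance Definition _ (X : normedModType K) :=
  NormedModule.copy (dual X) (operator X K^o).

(* The expectation is the average over all choices of signs. *)
Definition cotype (q : R) (X : normedModType K) : Prop :=
  2 <= q /\ exists C : R, forall (n : nat) (x : 'I_n -> X),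
    (\sum_(i < n) rnorm (x i) `^ q) `^ q^-1 <=
    C * Num.sqrt ((2 ^+ n)^-1 *
      \sum_(e : {ffun 'I_n -> bool}) rnorm (\sum_(i < n) (-1) ^+ e i *: x i) ^+ 2).

Definition finite_cotype (X : normedModType K) : Prop :=
  exists q : R, cotype q X.

Definition ell1 (X : normedModType K) : Type := ell X (lexx 1%E).

HB.instance Definition _ (X : normedModType K) :=
  NormedModule.copy (ell1 X) (ell X (lexx 1%E)).

End factorisation.

(* Main.v *)
Require Import Defs.
From mathcomp Require Import all_boot all_order all_algebra.
From mathcomp Require Import complex.
From mathcomp Require Import all_classical all_reals all_analysis.
From mathcomp Require Import ring lra.
Import numFieldNormedType.Exports.
Import Order.TTheory GRing.Theory Num.Theory.
Set Implicit Arguments.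
Unset Strict Implicit.
Unset Printing Implicit Defensive.
Local Open Scope classical_set_scope.
Local Open Scope ring_scope.

(** View an operator [T] on [ell1 X] as a matrix of operators [T_ij] on [X].  Its
    columns are bounded operators from [X] to [ell1 X].  Suppose first that a
    subset of the indices can be found on which all the off-diagonal columns are
    small.  The uniform primary factorisation property of [X] makes the identity
    of [X] factor, with a fixed constant, through [T_ii] or through [1 - T_ii] for
    each index [i]; one of the two happens infinitely often.  Restricting [T], or
    [1 - T], to these rows and columns and composing with the diagonal operators
    given by the factorisations yields a small perturbation of the identity of
    [ell1 X], which is invertible by a Neumann series.  This is
    [UPFP_ell1_of_non_spreading].

    The entries below the diagonal would be easy to make small if the norms of
    the entries of a column tended to zero, but for the entries above it there is
    no convergence along a row to exploit.  Both parts are controlled by the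
    property [non_spreading]: [X] has copies [J k X] of itself, with projections
    [Q k], such that an operator from [X] to [ell1 X] cannot be large on many
    copies in disjoint blocks of coordinates.  Hence a column has small tails on
    some copy ([non_spreading_tail]); and among finitely many rows every column
    has one in which its entry is small on almost all copies, so that by the
    pigeonhole principle one row is good for infinitely many columns
    ([non_spreading_row]).  Choosing rows one after the other and shrinking the
    set of remaining indices gives the almost diagonal submatrix
    ([almost_diagonal]).

    If [X] is isomorphic to [ell_p(X)] with [p > 1], or to [c0(X)], the copies are
    the coordinate subspaces: [n] unit vectors in distinct copies have signed sums
    of norm at most [n^(1/p)] up to a constant (at most a constant in the case of
    [ell_oo(X)] or [c0(X)]), while averaging over the signs shows that
    large images in [n] disjoint blocks would force a norm proportional to [n]
    ([non_spreading_coordinates]).  If [X^*] has finite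
    cotype, one takes [J k = Q k = id]: by the Hahn-Banach theorem, large images
    in [n] disjoint blocks would give [n] large functionals all of whose signed
    sums are bounded ([non_spreading_cotype]).  If [X] is isomorphic to
    [ell_1(X)], the property is simply transported along the isomorphism.

    Finally [ell1 X] is isomorphic to [ell1 (ell1 X)], so that Pelczynski's
    decomposition method applies: if the identity of [ell1 X] factors through a
    projection, the range of the projection is isomorphic to [ell1 X]
    ([UPFP_ell1_primary]). *)

(** * Bounded linear maps *)

Section Linear.
Variables (K : pzRingType) (U V : lmodType K) (f : U -> V).
Hypothesis lf : linear f.

Lemma linear_map0 : f 0 = 0.
Proof. by have := lf (-1) 0 0; rewrite !scaleN1r !addNr. Qed.

Lemma linear_mapD : {morph f : x y / x + y}.
Proof. by move=> x y; have := lf 1 x y; rewrite !scale1r. Qed.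

Lemma linear_mapZ a x : f (a *: x) = a *: f x.
Proof. by have := lf a x 0; rewrite linear_map0 !addr0. Qed.

Lemma linear_mapN x : f (- x) = - f x.
Proof. by rewrite -!scaleN1r linear_mapZ. Qed.

Lemma linear_mapB x y : f (x - y) = f x - f y.
Proof. by rewrite linear_mapD linear_mapN. Qed.

Lemma linear_map_sum (I : Type) (r : seq I) (P : pred I) (F : I -> U) :
  f (\sum_(i <- r | P i) F i) = \sum_(i <- r | P i) f (F i).
Proof. exact: (big_morph f linear_mapD linear_map0). Qed.

End Linear.

Section Norm.
Context (R : realType) (s : scalars).
Local Notation K := (scalar_field R s).

Lemma rabs_of_real (a : R) : 0 <= a -> rabs (of_real s a) = a.
Proof.
move=> a0; apply: (@of_real_inj _ s); rewrite of_real_rabs ger0_norm//.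
by rewrite -(of_real0 R s) ler_of_real.
Qed.

Lemma of_real1 : of_real s 1 = 1 :> K.
Proof. by case: s. Qed.

Lemma rabs_sign (b : bool) : rabs ((-1) ^+ b : K) = 1.
Proof.
apply: (@of_real_inj _ s); rewrite of_real_rabs of_real1.
by rewrite normrX normrN1 expr1n.
Qed.

Variable X : normedModType K.
Implicit Types x y : X.

Lemma rnormN x : rnorm (- x) = rnorm x.
Proof. by rewrite /rnorm normrN. Qed.

Lemma ler_rnormB x y : rnorm (x - y) <= rnorm x + rnorm y.
Proof. by rewrite -(rnormN y) ler_rnormD. Qed.

Lemma ler_rnorm_dist x y : rnorm x - rnorm y <= rnorm (x - y).
Proof. by rewrite lerBlDr -[X in rnorm X <= _](subrK y) ler_rnormD. Qed.

Lemma ler_rnorm_sum (I : Type) (r : seq I) (P : pred I) (F : I -> X) :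
  rnorm (\sum_(i <- r | P i) F i) <= \sum_(i <- r | P i) rnorm (F i).
Proof.
elim/big_ind2 : _ => //; first by rewrite rnorm0.
by move=> a b c d ab cd; rewrite (le_trans (ler_rnormD _ _))// lerD.
Qed.

Lemma rnorm_sign (b : bool) x : rnorm ((-1) ^+ b *: x) = rnorm x.
Proof. by rewrite rnormZ rabs_sign mul1r. Qed.

End Norm.

Section Bounded.
Context (R : realType) (s : scalars).
Local Notation K := (scalar_field R s).

(** A linear map of norm at most [M]; keeping the bound apart from the map
    makes every norm estimate below an elementary inequality. *)
Definition bounded_by (X Y : normedModType K) (M : R) (f : X -> Y) :=
  [/\ linear f, 0 <= M & forall x, rnorm (f x) <= M * rnorm x].

Section One.
Variables X Y : normedModType K.
Implicit Types f g : X -> Y.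

Lemma bounded_by_linear M f : bounded_by M f -> linear f.
Proof. by case. Qed.

Lemma bounded_by_ge0 M f : bounded_by M f -> 0 <= M.
Proof. by case. Qed.

Lemma bounded_byE M f x : bounded_by M f -> rnorm (f x) <= M * rnorm x.
Proof. by case. Qed.

Lemma bounded_by_le M N f : M <= N -> bounded_by M f -> bounded_by N f.
Proof.
move=> MN [lf M0 fM]; split=> // [|x]; first exact: le_trans MN.
by rewrite (le_trans (fM x))// ler_wpM2r ?rnorm_ge0.
Qed.

Lemma bounded_by_ball M f x : bounded_by M f -> rnorm x <= 1 ->
  rnorm (f x) <= M.
Proof.
by move=> [_ M0 fM] x1; rewrite (le_trans (fM x))// ler_piMr.
Qed.

Lemma operator_bounded_by (T : operator X Y) : bounded_by (rnorm T) T.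
Proof.
split; [exact: (operatorP T).1|exact: rnorm_ge0|move=> x].
by rewrite rnorm_operator; exact/ler_opnorm/operatorP.
Qed.

Lemma rnorm_operator_le M (T : operator X Y) :
  0 <= M -> (forall x, rnorm (T x) <= M * rnorm x) -> rnorm T <= M.
Proof.
move=> M0 TM; have TMb : bounded_by M T by split=> //; exact: (operatorP T).1.
rewrite rnorm_operator; apply: ge_sup.
  by exists (rnorm (T 0)), 0; rewrite //= rnorm0.
by move=> _ [x /= x1 <-]; exact: bounded_by_ball TMb x1.
Qed.

Lemma bounded_by_operator M f : bounded_by M f ->
  exists2 T : operator X Y, T =1 f & rnorm T <= M.
Proof.
move=> [lf M0 fM]; have fP : is_operator f by split => //; exists M.
exists (NSpace (asboolT fP : f \in ns_pred (operator_ns X Y))) => //.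
exact: rnorm_operator_le.
Qed.

Lemma bounded_byD M N f g : bounded_by M f -> bounded_by N g ->
  bounded_by (M + N) (fun x => f x + g x).
Proof.
move=> [lf M0 fM] [lg N0 gN]; split; [|exact: addr_ge0|move=> x].
  by move=> a x y /=; rewrite lf lg scalerDr addrACA.
by rewrite (le_trans (ler_rnormD _ _))// mulrDl lerD.
Qed.

Lemma bounded_byN M f : bounded_by M f -> bounded_by M (fun x => - f x).
Proof.
move=> [lf M0 fM]; split => // [a x y|x]; last by rewrite rnormN.
by rewrite lf opprD scalerN.
Qed.

Lemma bounded_byB M N f g : bounded_by M f -> bounded_by N g ->
  bounded_by (M + N) (fun x => f x - g x).
Proof. by move=> fM /bounded_byN gN; exact: bounded_byD. Qed.

Lemma bounded_byZ M f a : 0 <= a -> bounded_by M f ->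
  bounded_by (a * M) (fun x => of_real s a *: f x).
Proof.
move=> a0 [lf M0 fM]; split; [|exact: mulr_ge0|move=> x].
  by move=> b x y; rewrite lf scalerDr !scalerA mulrC.
by rewrite rnormZ rabs_of_real// -mulrA ler_wpM2l.
Qed.

Lemma eq_bounded_by M f g : f =1 g -> bounded_by M f -> bounded_by M g.
Proof. by move=> /funext ->. Qed.

End One.

Lemma bounded_by_id (X : normedModType K) : bounded_by 1 (@id X).
Proof. by split=> // x; rewrite mul1r. Qed.

Lemma bounded_by_comp (X Y Z : normedModType K) M N (f : Y -> Z) (g : X -> Y) :
  bounded_by M f -> bounded_by N g -> bounded_by (M * N) (fun x => f (g x)).
Proof.
move=> [lf M0 fM] [lg N0 gN]; split; [|exact: mulr_ge0|move=> x].
  by move=> a x y; rewrite lg lf.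
by rewrite (le_trans (fM _))// -mulrA ler_wpM2l.
Qed.

Lemma factors_throughI (C a b : R) (Z W X Y : normedModType K)
    (S : operator Z W) (T : operator X Y) (V : Z -> X) (U : Y -> W) :
  bounded_by a U -> bounded_by b V -> a * b <= C ->
  (forall z, U (T (V z)) = S z) -> factors_through C S T.
Proof.
move=> Ua Vb abC UTV.
have [U' U'E U'a] := bounded_by_operator Ua.
have [V' V'E V'b] := bounded_by_operator Vb.
exists V', U'; split=> [z /=|]; first by rewrite V'E U'E.
by rewrite (le_trans _ abC)// ler_pM ?rnorm_ge0.
Qed.

Lemma factors_throughP (C : R) (Z W X Y : normedModType K)
    (S : operator Z W) (T : operator X Y) : factors_through C S T ->
  exists (V : Z -> X) (U : Y -> W) (a b : R),
    [/\ bounded_by a U, bounded_by b V, a * b <= C &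
    forall z, U (T (V z)) = S z].
Proof.
move=> [V [U [UTV UVC]]]; exists V, U, (rnorm U), (rnorm V).
by split=> //; exact: operator_bounded_by.
Qed.

Lemma isomorphicI (X Y : normedModType K) (f : X -> Y) (g : Y -> X) M N :
  bounded_by M f -> bounded_by N g -> cancel f g -> cancel g f ->
  isomorphic X Y.
Proof.
move=> /bounded_by_operator[T TE _] /bounded_by_operator[S SE _] fg gf.
by exists T, S; split=> x; rewrite TE SE.
Qed.

Lemma op_funB (X Y : normedModType K) (S T : operator X Y) x :
  op_fun (S - T) x = S x - T x.
Proof. by []. Qed.

Lemma op_funZ (X Y : normedModType K) a (T : operator X Y) x :
  op_fun (a *: T) x = a *: T x.
Proof. by []. Qed.

Lemma op_fun_sum (X Y : normedModType K) (I : Type) (r : seq I) (P : pred I)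
    (F : I -> operator X Y) x :
  op_fun (\sum_(i <- r | P i) F i) x = \sum_(i <- r | P i) F i x.
Proof. exact: (big_morph (fun T : operator X Y => T x)). Qed.

(** The map in a factorisation of the identity can be rescaled so that the
    whole constant sits on the left factor. *)
Lemma normalized_factorisation (C : R) (X : normedModType K)
    (T : operator X X) : 0 <= C -> factors_through C (id_op X) T ->
  exists A B : X -> X, [/\ bounded_by C A, bounded_by 1 B &
    forall x, A (T (B x)) = x].
Proof.
move=> C0 /factors_throughP[V [U [a [b [Ua Vb abC UTV]]]]].
have b0 := bounded_by_ge0 Vb; have a0 := bounded_by_ge0 Ua.
have [lU _ _] := Ua; have [lV _ _] := Vb.
have lT : linear T := (operatorP T).1.
have [b00|bn0] := eqVneq b 0.
  (* [V = 0], and [X] is the zero space *)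
  have X0 (x : X) : x = 0.
    have Vx0 : V x = 0.
      apply/rnorm0_eq0/eqP; rewrite eq_le rnorm_ge0 andbT.
      by rewrite (le_trans (bounded_byE x Vb))// b00 mul0r.
    by rewrite -[LHS](UTV x) Vx0 !linear_map0.
  exists id, id; split => [||x]; last by rewrite [LHS]X0 [RHS]X0.
    by split=> // x; rewrite (X0 x) rnorm0 mulr0.
  exact: bounded_by_id.
have bV0 : 0 <= b^-1 by rewrite invr_ge0.
exists (fun x => of_real s b *: U x), (fun x => of_real s b^-1 *: V x); split.
- apply: (@bounded_by_le _ _ (b * a)); last exact: bounded_byZ.
  by rewrite mulrC.
- by have := bounded_byZ bV0 Vb; rewrite mulVf.
- move=> x; rewrite linear_mapZ// linear_mapZ// UTV /= scalerA.
  by rewrite -of_realM mulfV// of_real1 scale1r.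
Qed.

End Bounded.

(** * Partial sums of nonnegative reals *)

Section PartialSums.
Variable R : realType.
Implicit Types f g : nat -> R.

Lemma ler_sum_widen f (P : pred nat) m n : (forall i, 0 <= f i) ->
  (m <= n)%N -> \sum_(i < m | P i) f i <= \sum_(i < n | P i) f i.
Proof.
move=> f0 mn; rewrite (big_ord_widen_cond n P f mn) big_mkcondr /=.
by apply: ler_sum => i _; case: ifP.
Qed.

Lemma ler_sum_subpred f (P Q : pred nat) n : (forall i, 0 <= f i) ->
  (forall i, P i -> Q i) ->
  \sum_(i < n | P i) f i <= \sum_(i < n | Q i) f i.
Proof.
move=> f0 PQ; rewrite big_mkcond [leRHS]big_mkcond /=.
apply: ler_sum => i _; case: ifP => [/PQ -> //|_]; by case: ifP.
Qed.

Lemma ler_sum_all f (P : pred nat) n : (forall i, 0 <= f i) ->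
  \sum_(i < n | P i) f i <= \sum_(i < n) f i.
Proof. by move=> f0; apply: (@ler_sum_subpred f P predT). Qed.

(** Sums along a strictly increasing sequence of indices. *)
Lemma ler_sum_subseq f (h : nat -> nat) n : (forall i, 0 <= f i) ->
  (forall i, (h i < h i.+1)%N) -> \sum_(i < n) f (h i) <= \sum_(i < h n) f i.
Proof.
move=> f0 hS; elim: n => [|n IHn]; first by rewrite big_ord0 sumr_ge0.
rewrite big_ord_recr /=; apply: le_trans (_ : _ <= \sum_(i < (h n).+1) f i) _.
  by rewrite big_ord_recr /= lerD2r.
by apply: (@ler_sum_widen f predT).
Qed.

Lemma homo_ltn_of_succ (h : nat -> nat) :
  (forall i, (h i < h i.+1)%N) -> {homo h : i j / (i < j)%N}.
Proof. by move=> hS; apply: homo_ltn => //; exact: ltn_trans. Qed.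

Lemma leq_id_incr (h : nat -> nat) i : (forall i, (h i < h i.+1)%N) ->
  (i <= h i)%N.
Proof. by move=> hS; elim: i => // i IHi; exact: leq_ltn_trans IHi (hS i). Qed.

Lemma incr_inj (h : nat -> nat) : (forall i, (h i < h i.+1)%N) -> injective h.
Proof.
move=> /homo_ltn_of_succ hS i j hij; apply/eqP; rewrite eqn_leq.
by apply/andP; split; rewrite leqNgt; apply/negP => /hS; rewrite hij ltnn.
Qed.

(** An infinite set of indices contains a strictly increasing sequence. *)
Lemma incr_subseq (P : nat -> Prop) :
  (forall n, exists2 r, (n <= r)%N & P r) ->
  exists2 h : nat -> nat, (forall i, (h i < h i.+1)%N) & forall i, P (h i).
Proof.
move=> Pinf; have /choice[f fP] n : exists r, (n <= r)%N /\ P r.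
  by have [r nr Pr] := Pinf n; exists r.
pose h := fix h i := if i is i'.+1 then f (h i').+1 else f 0%N.
exists h => [i|[|i]]; [exact: (fP _).1|exact: (fP _).2|exact: (fP _).2].
Qed.

End PartialSums.

(** * The space of absolutely summable sequences *)

Section Ell1.
Context (R : realType) (s : scalars).
Local Notation K := (scalar_field R s).
Variable X : normedModType K.
Implicit Types (x y : ell1 X) (f : nat -> X).

Lemma lp_norm1E f : lp_norm 1%E f = (\sum_(n <oo) (rnorm (f n))%:E)%E.
Proof.
rewrite lp_normE// invr1 poweRe1; last first.
  by apply: nneseries_ge0 => n _ _; rewrite lee_fin powR_ge0.
by apply: eq_eseriesr => n _; rewrite powRr1 ?rnorm_ge0.
Qed.

Lemma lp_norm1_le f M : (forall N, \sum_(i < N) rnorm (f i) <= M) ->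
  (lp_norm 1%E f <= M%:E)%E.
Proof.
move=> fM; rewrite lp_norm1E; apply: lime_le.
  by apply: is_cvg_nneseries => n _ _; rewrite lee_fin rnorm_ge0.
by apply: nearW => N; rewrite big_mkord sumEFin lee_fin.
Qed.

(** The sequence [f] as an element of [ell1 X]; the value is [0] when [f] is
    not absolutely summable. *)
Definition ell1_of (f : nat -> X) : ell1 X :=
  insubd (0 : nspace (ell_ns X (lexx 1%E))) f.

Lemma ell1_ofE f M : (forall N, \sum_(i < N) rnorm (f i) <= M) ->
  ns_val (ell1_of f) = f.
Proof.
move=> fM; rewrite /ell1_of insubdK//; apply/asboolP => /=.
by rewrite (le_lt_trans (lp_norm1_le fM))// ltry.
Qed.

Lemma ell1_ext x y : ns_val x =1 ns_val y -> x = y.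
Proof. by move=> xy; apply: val_inj; exact/funext. Qed.

Lemma rnorm_ell1_le x M : (forall N, \sum_(i < N) rnorm (ns_val x i) <= M) ->
  rnorm x <= M.
Proof.
move=> /lp_norm1_le xM; have -> : rnorm x = fine (lp_norm 1%E (ns_val x)).
  exact: rnorm_ell.
rewrite -lee_fin fineK// ge0_fin_numE ?lp_norm_ge0//.
by rewrite (le_lt_trans xM)// ltry.
Qed.

Lemma ler_sum_rnorm_ell1 x N : \sum_(i < N) rnorm (ns_val x i) <= rnorm x.
Proof.
have -> : rnorm x = fine (lp_norm 1%E (ns_val x)) by exact: rnorm_ell.
have xoo : (lp_norm 1%E (ns_val x) < +oo)%E by exact: (ns_valE x).
rewrite -lee_fin fineK; last by rewrite ge0_fin_numE ?lp_norm_ge0.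
rewrite lp_norm1E -sumEFin -(big_mkord predT (fun i => (rnorm (ns_val x i))%:E)).
by apply: nneseries_lim_ge => i _ _; rewrite lee_fin rnorm_ge0.
Qed.

Lemma ns_val_lin a x y i :
  ns_val (a *: x + y) i = a *: ns_val x i + ns_val y i.
Proof. by []. Qed.

Lemma ns_valB x y i : ns_val (x - y) i = ns_val x i - ns_val y i.
Proof. by []. Qed.

Lemma ns_valD x y i : ns_val (x + y) i = ns_val x i + ns_val y i.
Proof. by []. Qed.

Lemma ns_val_sum (I : Type) (r : seq I) (P : pred I) (F : I -> ell1 X) i :
  ns_val (\sum_(j <- r | P j) F j) i = \sum_(j <- r | P j) ns_val (F j) i.
Proof. exact: (big_morph (fun x : ell1 X => ns_val x i)). Qed.

Lemma bounded_by_coord i : bounded_by 1 (fun x => ns_val x i).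
Proof.
split=> // x; rewrite mul1r (le_trans _ (ler_sum_rnorm_ell1 x i.+1))//.
by rewrite big_ord_recr /= lerDr sumr_ge0// => j _; exact: rnorm_ge0.
Qed.

(** A map into [ell1 X] is given by its coordinates. *)
Lemma bounded_by_ell1_of (Z : normedModType K) (M : R) (F : Z -> nat -> X) :
  0 <= M -> (forall i, linear (fun z => F z i)) ->
  (forall z N, \sum_(i < N) rnorm (F z i) <= M * rnorm z) ->
  bounded_by M (fun z => ell1_of (F z)) /\
  (forall z, ns_val (ell1_of (F z)) = F z).
Proof.
move=> M0 lF FM; have FE z : ns_val (ell1_of (F z)) = F z.
  exact: ell1_ofE (FM z).
split=> //; split=> // [a x y|z]; last by apply: rnorm_ell1_le => N; rewrite FE.
by apply: ell1_ext => i; rewrite ns_val_lin !FE lF.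
Qed.

(** The sequence with [u] at position [n] and [0] elsewhere. *)
Definition single (n : nat) (u : X) : ell1 X :=
  ell1_of (fun i => if i == n then u else 0).

Lemma sum_single_le n N (u : X) :
  \sum_(i < N) rnorm (if i == n :> nat then u else 0) <= 1 * rnorm u.
Proof.
rewrite mul1r; have [nN|Nn] := ltnP n N.
  rewrite (bigD1 (Ordinal nN))//= eqxx big1 ?addr0// => i.
  by rewrite -val_eqE /= => /negbTE ->; rewrite rnorm0.
rewrite big1 ?rnorm_ge0// => i _.
by rewrite ltn_eqF ?rnorm0// (leq_trans (ltn_ord i)).
Qed.

Let single_spec n : bounded_by 1 (single n) /\
  forall u, ns_val (single n u) = fun i => if i == n then u else 0.
Proof.
apply: bounded_by_ell1_of => // [i a u v|u N]; last exact: sum_single_le.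
by case: ifP => _ //; rewrite scaler0 addr0.
Qed.

Lemma bounded_by_single n : bounded_by 1 (single n).
Proof. exact: (single_spec n).1. Qed.

Lemma singleE n u i : ns_val (single n u) i = if i == n then u else 0.
Proof. by rewrite (single_spec n).2. Qed.

(** Finitely supported sequences are dense. *)
Lemma ell1_truncate x e : 0 < e -> exists N,
  rnorm (x - \sum_(n < N) single n (ns_val x n)) <= e.
Proof.
move=> e0; have [N Nx] : exists N,
    rnorm x - e < \sum_(i < N) rnorm (ns_val x i).
  apply: contrapT => /forallNP xe.
  suff : rnorm x <= rnorm x - e by move=> h; lra.
  by apply: rnorm_ell1_le => N; rewrite leNgt; apply/negP/xe.
exists N; apply: rnorm_ell1_le => N'.
have trE i : ns_val (x - \sum_(n < N) single n (ns_val x n)) i =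
    if (i < N)%N then 0 else ns_val x i.
  rewrite ns_valB ns_val_sum; case: ltnP => [iN|Ni].
    rewrite (bigD1 (Ordinal iN))//= singleE eqxx big1 ?addr0 ?subrr// => j.
    by rewrite singleE -val_eqE eq_sym /= => /negbTE ->.
  rewrite big1 ?subr0// => j _.
  by rewrite singleE gtn_eqF// (leq_trans (ltn_ord j)).
rewrite leNgt; apply/negP => eN'.
have := ler_sum_rnorm_ell1 x (maxn N N'); rewrite leNgt => /negP; apply.
apply: lt_le_trans (_ : \sum_(i < N) rnorm (ns_val x i) + e <= _).
  by rewrite -ltrBlDr.
apply: le_trans (_ : \sum_(i < N) rnorm (ns_val x i) + \sum_(i < N')
   rnorm (if (i < N)%N then 0 else ns_val x i) <= _).
  by rewrite lerD2l (le_trans (ltW eN'))//; apply: ler_sum => i _; rewrite trE.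
rewrite (big_ord_widen (maxn N N') (fun i => rnorm (ns_val x i)) (leq_maxl _ _)).
rewrite (big_ord_widen (maxn N N')
  (fun i => rnorm (if (i < N)%N then 0 else ns_val x i)) (leq_maxr _ _)).
rewrite big_mkcond [X in _ + X]big_mkcond -big_split /=.
apply: ler_sum => i _; case: ifP; case: ifP => _ _ //; rewrite ?rnorm0 ?addr0 ?add0r//.
exact: rnorm_ge0.
Qed.

(** An operator on [ell1 X] has norm the supremum of the norms of its
    columns. *)
Lemma bounded_by_columns (W : normedModType K) (M L : R) (E : ell1 X -> W) :
  0 <= M -> bounded_by L E ->
  (forall n u, rnorm (E (single n u)) <= M * rnorm u) -> bounded_by M E.
Proof.
move=> M0 EL EM; have lE := bounded_by_linear EL; split=> // x.
apply/ler_addgt0Pr => e e0.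
have [|N xN] := @ell1_truncate x (e / (L + 1)).
  by rewrite divr_gt0// ltr_wpDl// (bounded_by_ge0 EL).
set y := \sum_(n < N) _ in xN.
have L1 : 0 < L + 1 by rewrite ltr_wpDl// (bounded_by_ge0 EL).
have -> : E x = E y + E (x - y) by rewrite -linear_mapD// addrC subrK.
rewrite (le_trans (ler_rnormD _ _))// lerD//; last first.
  rewrite (le_trans (bounded_byE _ EL))//.
  apply: le_trans (ler_wpM2l (bounded_by_ge0 EL) xN) _.
  by rewrite mulrA ler_pdivrMr// mulrC ler_pM2l// lerDl.
rewrite linear_map_sum// (le_trans (ler_rnorm_sum _ _ _))//.
apply: le_trans (_ : \sum_(n < N) M * rnorm (ns_val x n) <= _).
  by apply: ler_sum => n _; exact: EM.
by rewrite -mulr_sumr ler_wpM2l// ler_sum_rnorm_ell1.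
Qed.

End Ell1.

(** * Completeness and small perturbations of the identity *)

Section Completeness.
Context (R : realType) (s : scalars).
Local Notation K := (scalar_field R s).

(** A sequence whose successive differences are dominated by a geometric
    progression has a limit, at the expected rate.  For a normed space this is
    a quantitative form of completeness. *)
Definition geometrically_complete (X : normedModType K) := forall (c : R)
  (z : nat -> X), (forall m, rnorm (z m.+1 - z m) <= c / 2 ^+ m) ->
  exists l, forall m, rnorm (l - z m) <= 2 * c / 2 ^+ m.

Lemma ler_geometric_dist (X : normedModType K) (c : R) (z : nat -> X) :
  (forall m, rnorm (z m.+1 - z m) <= c / 2 ^+ m) ->
  forall m n, (m <= n)%N -> rnorm (z n - z m) <= 2 * c / 2 ^+ m.
Proof.
move=> zc m n mn.
have c0 : 0 <= c by have := zc 0%N; rewrite expr0 divr1; apply: le_trans (rnorm_ge0 _).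
apply: le_trans (_ : 2 * c / 2 ^+ m - 2 * c / 2 ^+ n <= _); last first.
  by rewrite gerBl divr_ge0 ?mulr_ge0// exprn_ge0.
elim: n mn => [|n IHn].
  by rewrite leqn0 => /eqP ->; rewrite !subrr rnorm0.
rewrite leq_eqVlt => /predU1P[->|]; first by rewrite !subrr rnorm0.
rewrite ltnS => /IHn zmn.
rewrite -[z n.+1](subrK (z n)) -addrA (le_trans (ler_rnormD _ _))//.
apply: le_trans (lerD (zc n) zmn) _; rewrite exprS.
have : 2 ^+ n != 0 :> R by rewrite expf_neq0.
move: (2 ^+ n) => t t0.
rewrite le_eqVlt; apply/orP; left; apply/eqP; field.
by rewrite t0 expf_neq0.
Qed.

Lemma lt_geometric (c e : R) : 0 < e -> exists m, c / 2 ^+ m < e.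
Proof.
move=> e0; have [m cm] : exists m, c / e < m%:R.
  by exists (Num.truncn `|c / e|).+1; rewrite (le_lt_trans (ler_norm _))// truncnS_gt.
exists m; rewrite ltr_pdivrMr ?exprn_gt0// mulrC -ltr_pdivrMr//.
rewrite (lt_le_trans cm)// -natrX ler_nat; exact/ltnW/ltn_expl.
Qed.

Lemma complete_geometrically_complete (X : completeNormedModType K) :
  geometrically_complete X.
Proof.
move=> c z zc; have zd := ler_geometric_dist zc.
(* the topology of [X] is described by radii in [K], the estimates by reals *)
have posK (e : K) : 0 < e -> 0 < real_part e.
  move=> e0; rewrite lt_neqAle -(ler_of_real s) (real_partK (ltW e0)) of_real0 ltW// andbT.
  by apply/eqP => e0'; move: (e0); rewrite -(real_partK (ltW e0)) -e0' of_real0 ltxx.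
have ballK (x y : X) (e : K) : 0 < e -> rnorm (x - y) < real_part e -> `|x - y| < e.
  move=> e0; rewrite -{2}(real_partK (ltW e0)) -of_real_rnorm.
  rewrite lt_neqAle => /andP[xy xye]; rewrite lt_neqAle ler_of_real xye andbT.
  by apply: contra xy => /eqP/of_real_inj ->.
have zcvg : cvg (z @ \oo).
  apply/cauchy_cvgP/cauchy_exP => e e0.
  have [m me] := lt_geometric (2 * c) (posK _ e0).
  exists (z m); exists m => // n mn; rewrite -ball_normE; apply: ballK => //.
  by rewrite -rnormN opprB (le_lt_trans _ me)// zd.
exists (lim (z @ \oo)) => m; apply/ler_addgt0Pr => e e0.
have e0K : 0 < of_real s e.
  rewrite lt_neqAle -[X in _ && (X <= _)](of_real0 R s) ler_of_real ltW// andbT.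
  by apply: contraTneq e0 => e0; rewrite (@of_real_inj _ s e 0) ?ltxx// of_real0.
have /cvgrPdist_lt/(_ _ e0K)[N _ zN] := zcvg.
have := zN (maxn N m) (leq_maxl _ _); rewrite -of_real_rnorm => /ltW.
rewrite ler_of_real => lzN.
rewrite -(subrK (z (maxn N m)) (lim _)) -addrA (le_trans (ler_rnormD _ _))//.
by apply: le_trans (lerD lzN (zd _ _ (leq_maxr N m))) _; rewrite addrC.
Qed.

Lemma ell1_geometrically_complete (X : normedModType K) :
  geometrically_complete X -> geometrically_complete (ell1 X).
Proof.
move=> Xc c z zc; have zd := ler_geometric_dist zc.
have c0 : 0 <= c by have := zc 0%N; rewrite expr0 divr1; apply: le_trans (rnorm_ge0 _).
have /choice[l lP] i : exists l, forall m, rnorm (l - ns_val (z m) i) <= 2 * c / 2 ^+ m.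
  apply: Xc => m; rewrite -ns_valB.
  by rewrite (le_trans (bounded_byE _ (bounded_by_coord X i)))// mul1r zc.
have lz m N : \sum_(i < N) rnorm (l i - ns_val (z m) i) <= 2 * c / 2 ^+ m.
  apply/ler_addgt0Pr => e e0.
  have [n ne] := lt_geometric (N%:R * (2 * c)) e0.
  pose n' := maxn n m.
  apply: le_trans (_ : \sum_(i < N) (rnorm (ns_val (z n' - z m) i) +
      rnorm (l i - ns_val (z n') i)) <= _).
    apply: ler_sum => i _.
    have -> : l i - ns_val (z m) i =
        ns_val (z n' - z m) i + (l i - ns_val (z n') i).
      by rewrite ns_valB [RHS]addrC addrA subrK.
    exact: ler_rnormD.
  rewrite big_split lerD//.
    exact: le_trans (ler_sum_rnorm_ell1 (z n' - z m) N) (zd _ _ (leq_maxr n m)).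
  apply: le_trans (_ : \sum_(i < N) 2 * c / 2 ^+ n' <= _).
    by apply: ler_sum => i _.
  rewrite sumr_const card_ord (le_trans _ (ltW ne))//.
  rewrite -[leLHS]mulr_natl mulrA.
  rewrite ler_wpM2l ?mulr_ge0// lef_pV2 ?posrE ?exprn_gt0//.
  by rewrite ler_eXn2l ?ltr1n//; exact: leq_maxl.
pose w m := ell1_of (fun i => l i - ns_val (z m) i).
have wE m : ns_val (w m) = fun i => l i - ns_val (z m) i := ell1_ofE (lz m).
exists (w 0%N + z 0%N) => m.
have -> : w 0%N + z 0%N - z m = w m.
  apply: ell1_ext => i; rewrite ns_valB wE.
  by rewrite ns_valD wE subrK.
by apply: rnorm_ell1_le => N; rewrite wE.
Qed.

(** A bounded map [f] at distance at most 1/2 from the identity is invertible, by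
    the Neumann series, and its inverse has norm at most 2. *)
Lemma near_identity_invertible (Y : normedModType K) M (f : Y -> Y) :
  geometrically_complete Y -> bounded_by M f ->
  bounded_by (2^-1) (fun y => f y - y) ->
  exists2 g : Y -> Y, bounded_by 2 g & cancel g f.
Proof.
move=> Yc fM fh; have lf := bounded_by_linear fM.
have fy y : rnorm (f y - y) <= 2^-1 * rnorm y := bounded_byE y fh.
have lower y : rnorm y <= 2 * rnorm (f y).
  have := ler_rnorm_dist y (f y); rewrite -[rnorm (y - f y)]rnormN opprB.
  by have := fy y; lra.
have finj y y' : f y = f y' -> y = y'.
  move=> ff; apply/eqP; rewrite -subr_eq0; apply/eqP/rnorm0_eq0/eqP.
  by rewrite eq_le rnorm_ge0 andbT (le_trans (lower _))// linear_mapB// ff subrr rnorm0 mulr0.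
have fsurj y : exists x, f x = y.
  (* Richardson iteration for the equation [f x = y] *)
  pose z := fix z m := if m is m'.+1 then z m' + (y - f (z m')) else 0.
  have res m : rnorm (y - f (z m)) <= rnorm y / 2 ^+ m.
    elim: m => [|m IHm] /=.
      by rewrite linear_map0// subr0 expr0 divr1.
    rewrite linear_mapD// opprD addrA -rnormN opprB (le_trans (fy _))//.
    by rewrite exprS invfM mulrCA ler_wpM2l// invr_ge0.
  have [|x xz] := Yc (rnorm y) z.
    by move=> m /=; rewrite [X in rnorm X]addrC addKr.
  exists x; apply/eqP; rewrite -subr_eq0; apply/eqP/rnorm0_eq0/eqP.
  rewrite eq_le rnorm_ge0 andbT; apply/ler_addgt0Pr => e e0; rewrite add0r.
  have [m me] := lt_geometric ((M * 2 + 1) * rnorm y) e0.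
  have -> : f x - y = f (x - z m) - (y - f (z m)).
    by rewrite linear_mapB// opprB addrA subrK.
  rewrite (le_trans (ler_rnormB _ _))// (le_trans _ (ltW me))//.
  rewrite mulrDl mul1r [leRHS]mulrDl lerD//.
  rewrite (le_trans (bounded_byE _ fM))// -!mulrA ler_wpM2l ?(bounded_by_ge0 fM)//.
  by rewrite mulrA.
have /choice[g gK] := fsurj.
exists g => //; split=> // [a x y|x]; last by rewrite (le_trans (lower _))// gK.
by apply: finj; rewrite lf !gK.
Qed.

End Completeness.

(** * Selecting an almost diagonal submatrix *)

Section Selection.
Context (R : realType) (s : scalars).
Local Notation K := (scalar_field R s).
Variable X : normedModType K.

(** The coordinates [t i] of an operator of norm at most [M] from [X] to
    [ell1 X]. *)
Definition column (M : R) (t : nat -> X -> X) :=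
  (forall i, linear (t i)) /\
  forall x N, \sum_(i < N) rnorm (t i x) <= M * rnorm x.

(** The space [X] contains uniformly complemented, uniformly isomorphic copies
    [J k X] of itself (not necessarily distinct), on which operators into
    [ell1 X] spread badly: an operator of norm at most [M] cannot send, for [n]
    different indices [k m], vectors of the copies to images that exceed the
    proportion [d] of their norms on [n] disjoint blocks [F m] of coordinates,
    where [n] depends only on [M] and [d]. *)
Definition non_spreading (C : R) (J Q : nat -> X -> X) :=
  [/\ forall k, bounded_by C (J k), forall k, bounded_by C (Q k),
    forall k x, Q k (J k x) = x &
    forall M d : R, 0 < d -> exists n, forall t, column M t ->
      forall N (F : nat -> pred nat) (k : nat -> nat) (x : nat -> X),
      (forall i m m', F m i -> F m' i -> m = m') -> injective k ->
      exists2 m, (m < n)%N &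
        \sum_(i < N | F m i) rnorm (t i (J (k m) (x m))) <= d * rnorm (x m)].

Variables (C : R) (J Q : nat -> X -> X).
Hypothesis JQ : non_spreading C J Q.

(** On some copy [J k X], with [k] arbitrarily large, the tails of a column are
    uniformly small: otherwise large pieces of images of vectors of successive
    copies could be found in successive intervals of coordinates. *)
Lemma non_spreading_tail (M d : R) (t : nat -> X -> X) g :
  0 < d -> column M t -> exists2 k, (g <= k)%N & exists N0, forall N x,
    \sum_(i < N | (N0 <= i)%N) rnorm (t i (J k x)) <= d * rnorm x.
Proof.
move=> d0 tM; apply: contrapT => bad.
have /choice[f fP] (p : nat * nat) : exists q : nat * X,
    d * rnorm q.2 < \sum_(i < q.1 | (p.2 <= i)%N) rnorm (t i (J (g + p.1) q.2)).
  apply: contrapT => good; apply: bad; exists (g + p.1)%N; first exact: leq_addr.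
  exists p.2 => N x; rewrite leNgt; apply/negP => lt.
  by apply: good; exists (N, x).
pose b := fix b m := if m is m'.+1 then (f (m', b m')).1 else 0%N.
pose x m := (f (m, b m)).2.
have big m : d * rnorm (x m) <
    \sum_(i < b m.+1 | (b m <= i)%N) rnorm (t i (J (g + m) (x m))).
  exact: (fP (m, b m)).
have bS m : (b m < b m.+1)%N.
  rewrite ltnNge; apply/negP => bm; have := big m.
  rewrite big1 => [|i bi].
    by rewrite ltNge mulr_ge0 ?rnorm_ge0// ltW.
  by have := leq_trans bm bi; rewrite leqNgt ltn_ord.
have bmono := homo_ltn_of_succ bS.
have bmonoW i j : (i <= j)%N -> (b i <= b j)%N.
  by rewrite leq_eqVlt => /predU1P[->//|/bmono/ltnW].
have [_ _ _ /(_ M _ d0)[n nP]] := JQ.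
pose F m i := (b m <= i < b m.+1)%N.
have Fdisj i m m' : F m i -> F m' i -> m = m'.
  suff lt a a' : F a i -> F a' i -> (a < a')%N -> False.
    by move=> Fm Fm'; case: (ltngtP m m') => // /lt; [move/(_ Fm Fm')|move/(_ Fm' Fm)].
  move=> /andP[_ ia] /andP[ai _] aa'.
  by have := leq_trans ia (leq_trans (bmonoW _ _ aa') ai); rewrite ltnn.
have [m mn] := nP t tM (b n) F (fun m => g + m)%N x Fdisj (@addnI g).
apply/negP; rewrite -ltNge; apply: lt_le_trans (big m) _.
by rewrite (big_ord_widen_cond (b n) (fun i => b m <= i)%N
  (fun i => rnorm (t i (J (g + m) (x m))))) ?bmonoW.
Qed.

(** Among finitely many rows, each column has one row in which its entry becomes
    small on the copies [J k X] for [k] large; by the pigeonhole principle the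
    same row serves infinitely many columns. *)
Lemma non_spreading_row (M d : R) (T : nat -> nat -> X -> X) (S : nat -> Prop) :
  0 < d -> (forall j, column M (fun i => T i j)) ->
  (forall n, exists2 r, (n <= r)%N & S r) ->
  exists2 i, S i & forall n, exists2 j, (n <= j)%N & S j /\
    exists g, forall k, (g <= k)%N -> forall x,
      rnorm (T i j (J k x)) <= d * rnorm x.
Proof.
move=> d0 TM Sinf; have [h hS Sh] := incr_subseq Sinf.
have [_ _ _ /(_ M _ d0)[n nP]] := JQ.
pose ev i j := exists g, forall k, (g <= k)%N -> forall x,
  rnorm (T i j (J k x)) <= d * rnorm x.
have /choice[c cP] j : exists m, (m < n)%N /\ ev (h m) j.
  apply: contrapT => bad.
  have /choice[f fP] (p : nat * nat) : exists q : nat * X, (p.2 <= q.1)%N /\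
      ((p.1 < n)%N -> d * rnorm q.2 < rnorm (T (h p.1) j (J q.1 q.2))).
    have [pn|pn] := ltnP p.1 n; last by exists (p.2, 0).
    apply: contrapT => good; apply: bad; exists p.1; split=> //.
    exists p.2 => k pk x; rewrite leNgt; apply/negP => lt.
    by apply: good; exists (k, x).
  pose b := fix b m := if m is m'.+1 then (f (m', b m')).1.+1 else 0%N.
  pose k m := (f (m, b m)).1.
  have kS m : (k m < k m.+1)%N by exact: (fP (m.+1, b m.+1)).1.
  have Fdisj i m m' : i == h m -> i == h m' -> m = m'.
    by move=> /eqP -> /eqP /(incr_inj hS).
  have [m mn] := nP (fun i => T i j) (TM j) (h n) (fun m i => i == h m) k
    (fun m => (f (m, b m)).2) Fdisj (incr_inj kS).
  have hmn : (h m < h n)%N by exact: homo_ltn_of_succ.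
  rewrite (bigD1 (Ordinal hmn))//= big1 ?addr0; last first.
    by move=> i /andP[/eqP im]; rewrite -val_eqE /= im eqxx.
  by apply/negP; rewrite -ltNge; exact: (fP (m, b m)).2.
have [m mn minf] : exists2 m, (m < n)%N & forall N, exists2 j, (N <= j)%N &
    S j /\ c j = m.
  apply: contrapT => fin.
  have /choice[B BP] m : exists N, (m < n)%N ->
      forall j, (N <= j)%N -> S j -> c j <> m.
    have [mn|_] := ltnP m n; last by exists 0%N.
    apply: contrapT => inf; apply: fin; exists m => // N.
    apply: contrapT => noj; apply: inf; exists N => _ j Nj Sj cj.
    by apply: noj; exists j.
  have [j Bj Sj] := Sinf (\max_(m < n) B m).
  have [cn _] := cP j; apply: (BP _ cn j) => //.
  by apply: leq_trans Bj; exact: (leq_bigmax (Ordinal cn)).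
exists (h m); first exact: Sh.
move=> N; have [j Nj [Sj cj]] := minf N; exists j => //; split=> //.
by have [_] := cP j; rewrite cj.
Qed.

Lemma sum_half_pow n : \sum_(i < n) (2 ^+ i.+1)^-1 = 1 - (2 ^+ n)^-1 :> R.
Proof.
elim: n => [|n IHn]; first by rewrite big_ord0 expr0 invr1 subrr.
rewrite big_ord_recr /= IHn exprS.
have : 2 ^+ n != 0 :> R by rewrite expf_neq0.
by move: (2 ^+ n) => a a0; field.
Qed.

(** One can choose indices [I r] and copies [J (k r) X] such that the matrix with
    rows and columns [I 0 < I 1 < ...], restricted to these copies, has small
    off-diagonal columns. *)
Lemma almost_diagonal (M e : R) (T : nat -> nat -> X -> X) :
  0 < e -> (forall j, column M (fun i => T i j)) ->
  exists I k : nat -> nat, (forall r, (I r < I r.+1)%N) /\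
  forall r L x, \sum_(l < L | l != r :> nat) rnorm (T (I l) (I r) (J (k r) x))
    <= e * rnorm x.
Proof.
(* The row chosen at step [r] contributes at most [d r] to each later column, for
   a total of [e / 2] above the diagonal; tails below it are at most [e / 2]. *)
move=> e0 TM; pose d r : R := e / 2 / 2 ^+ r.+1.
have d0 r : 0 < d r by rewrite !divr_gt0// exprn_gt0.
have e20 : 0 < e / 2 by rewrite divr_gt0.
(* A state is an infinite set [S] of admissible indices and a condition [H j k],
   which holds for [j] in [S] when [k] is large, on the later choices. *)
pose state := ((nat -> Prop) * (nat -> nat -> Prop))%type.
pose inv (S : state) := (forall n, exists2 r, (n <= r)%N & S.1 r) /\
  (forall j, S.1 j -> exists g, forall k, (g <= k)%N -> S.2 j k).
pose step r (S : state) (ik : nat * nat) (S' : state) :=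
  [/\ S.1 ik.1, S.2 ik.1 ik.2, forall j, S'.1 j -> S.1 j /\ (ik.1 < j)%N,
    forall j k, S'.2 j k -> S.2 j k /\
      forall x, rnorm (T ik.1 j (J k x)) <= d r * rnorm x &
    exists N0, (forall j, S'.1 j -> (N0 <= j)%N) /\ forall N x,
      \sum_(i < N | (N0 <= i)%N) rnorm (T i ik.1 (J ik.2 x)) <= e / 2 * rnorm x].
have stepP r S : inv S -> exists ik S', step r S ik S' /\ inv S'.
  move=> [Sinf SH]; have [i Si inf] := non_spreading_row (d0 r) TM Sinf.
  have [g gH] := SH i Si.
  have [k gk [N0 tail]] := non_spreading_tail g e20 (TM i).
  exists (i, k), (fun j => [/\ S.1 j, (maxn N0 i.+1 <= j)%N & exists g, forall k,
    (g <= k)%N -> forall x, rnorm (T i j (J k x)) <= d r * rnorm x],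
    fun j k => S.2 j k /\ forall x, rnorm (T i j (J k x)) <= d r * rnorm x).
  split; split=> //=.
  - exact: gH.
  - by move=> j [Sj]; rewrite geq_max => /andP[_ ij] _.
  - by exists N0; split=> // j [_]; rewrite geq_max => /andP[].
  - move=> n; have [j] := inf (maxn n (maxn N0 i.+1)).
    by rewrite geq_max => /andP[nj ij] [Sj jg]; exists j.
  - move=> j [Sj _ [g1 g1P]]; have [g2 g2P] := SH j Sj.
    exists (maxn g1 g2) => k'; rewrite geq_max => /andP[g1k g2k].
    by split; [exact: g2P|exact: g1P].
have /choice[f fP] (p : nat * state) : exists q : (nat * nat) * state,
    inv p.2 -> step p.1 p.2 q.1 q.2 /\ inv q.2.
  have [/(stepP p.1)[ik [S' ?]]|ninv] := pselect (inv p.2).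
    by exists (ik, S').
  by exists ((0, 0), p.2)%N.
pose st := fix st r : state :=
  if r is r'.+1 then (f (r', st r')).2 else (fun=> True, fun _ _ => True).
have stI r : inv (st r).
  elim: r => [|r IHr] /=; last exact: (fP (r, st r) IHr).2.
  by split=> [n|j _]; [exists n|exists 0%N].
pose I r := (f (r, st r)).1.1; pose k r := (f (r, st r)).1.2.
have stS r : step r (st r) (I r, k r) (st r.+1).
  have [] := fP (r, st r) (stI r); rewrite /I /k /=.
  by case: (f (r, st r)) => [[i k'] S'].
have st_sub r l : (r <= l)%N -> forall j, (st l).1 j -> (st r).1 j.
  elim: l => [|l IHl]; first by rewrite leqn0 => /eqP ->.
  rewrite leq_eqVlt => /predU1P[->//|]; rewrite ltnS => /IHl rl j Sj.
  by apply: rl; have [_ _ /(_ j Sj)[]] := stS l.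
have st_subH r l : (r <= l)%N -> forall j k, (st l).2 j k -> (st r).2 j k.
  elim: l => [|l IHl]; first by rewrite leqn0 => /eqP ->.
  rewrite leq_eqVlt => /predU1P[->//|]; rewrite ltnS => /IHl rl j k' Hjk.
  by apply: rl; have [_ _ _ /(_ j k' Hjk)[]] := stS l.
have IS r l : (r < l)%N -> (st r.+1).1 (I l).
  by move=> /st_sub; apply; have [] := stS l.
have IH r l : (r < l)%N -> (st r.+1).2 (I l) (k l).
  by move=> /st_subH; apply; have [] := stS l.
have Imono r : (I r < I r.+1)%N.
  by have [_ _ /(_ _ (IS r r.+1 (ltnSn r)))[]] := stS r.
exists I, k; split=> // r L x.
pose a i := rnorm (T i (I r) (J (k r) x)).
have a0 i : 0 <= a i by exact: rnorm_ge0.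
rewrite -/(a _) (bigID (fun l : 'I_L => l < r)%N) /=.
rewrite (splitr e) mulrDl lerD//.
- apply: le_trans (_ : \sum_(l < L) d l * rnorm x <= _).
    rewrite big_mkcond /=; apply: ler_sum => l _; case: ifP => [|_]; last first.
      by rewrite mulr_ge0 ?rnorm_ge0// ltW.
    by move=> /andP[_ /IH]; have [_ _ _ H _] := stS l; move=> /H[_]; exact.
  rewrite -mulr_suml ler_wpM2r ?rnorm_ge0// -mulr_sumr sum_half_pow.
  by rewrite ler_piMr ?ltW// ltrBlDr ltrDl invr_gt0 exprn_gt0.
- have [_ _ _ _ [N0 [N0P tail]]] := stS r.
  pose b i := if (N0 <= i)%N then a i else 0.
  have b0 i : 0 <= b i by rewrite /b; case: ifP.
  apply: le_trans (_ : \sum_(l < L) b (I l) <= _).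
    rewrite big_mkcond /=; apply: ler_sum => l _; case: ifP => //.
    rewrite -leqNgt => /andP[lr rl]; rewrite /b N0P//; apply: IS.
    by rewrite ltn_neqAle eq_sym lr.
  apply: (le_trans (@ler_sum_subseq R b I L b0 Imono)); rewrite -big_mkcond /=.
  exact: tail.
Qed.

End Selection.

(** * From almost diagonal submatrices to factorisations *)

Section Factorisation.
Context (R : realType) (s : scalars).
Local Notation K := (scalar_field R s).
Variable X : normedModType K.

(** The entry of the matrix of [T] at row [i] and column [j]. *)
Definition entry (T : ell1 X -> ell1 X) (i j : nat) (x : X) : X :=
  ns_val (T (single j x)) i.

Lemma entry_column (T : ell1 X -> ell1 X) M j :
  bounded_by M T -> column M (fun i => entry T i j).
Proof.
move=> TM; split=> [i|x N].
  have := bounded_by_comp (bounded_by_coord X i)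
    (bounded_by_comp TM (bounded_by_single X j)).
  exact: bounded_by_linear.
apply: le_trans (ler_sum_rnorm_ell1 _ _) _.
have := bounded_byE x (bounded_by_comp TM (bounded_by_single X j)).
by rewrite mulr1.
Qed.

(** If the compression of [T] to the rows and columns [I r], between the maps
    [b r] and [a r], has identity diagonal and small off-diagonal columns, it is
    close to the identity and hence invertible. *)
Lemma factors_almost_diagonal (T : operator (ell1 X) (ell1 X))
    (D1 D2 e : R) (a b : nat -> X -> X) (I : nat -> nat) :
  geometrically_complete X ->
  (forall r, bounded_by D1 (a r)) -> (forall r, bounded_by D2 (b r)) ->
  (forall r, (I r < I r.+1)%N) -> D1 * e <= 2^-1 ->
  (forall r L x, \sum_(l < L | l != r :> nat)
    rnorm (entry T (I l) (I r) (b r x)) <= e * rnorm x) ->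
  (forall r x, a r (entry T (I r) (I r) (b r x)) = x) ->
  factors_through (D1 * (D2 * 2)) (id_op (ell1 X)) T.
Proof.
move=> Xc aD bD IS D1e off diag.
have D10 := bounded_by_ge0 (aD 0%N); have D20 := bounded_by_ge0 (bD 0%N).
have Iinj := incr_inj IS.
(* [U] picks the rows [I r]; [V] puts the coordinate [r] in column [I r] *)
have [||U_bd UE] := @bounded_by_ell1_of _ _ X (ell1 X) D1
    (fun y r => a r (ns_val y (I r))) D10.
- move=> r; have := bounded_by_comp (aD r) (bounded_by_coord X (I r)).
  exact: bounded_by_linear.
- move=> y N; apply: le_trans (_ : \sum_(r < N) D1 * rnorm (ns_val y (I r)) <= _).
    by apply: ler_sum => r _; exact: bounded_byE.
  rewrite -mulr_sumr ler_wpM2l// (le_trans _ (ler_sum_rnorm_ell1 y (I N)))//.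
  by apply: (@ler_sum_subseq _ (fun i => rnorm (ns_val y i))) => // i; exact: rnorm_ge0.
set U := (fun y : ell1 X => ell1_of _) in U_bd UE.
have [||V_bd VE] := @bounded_by_ell1_of _ _ X (ell1 X) D2
    (fun x i => \sum_(r < i.+1 | I r == i) b r (ns_val x r)) D20.
- move=> i c x y; rewrite scaler_sumr -big_split /=.
  by apply: eq_bigr => r _; rewrite (bounded_by_linear (bD r)).
- move=> x N; apply: le_trans (_ : \sum_(i < N) \sum_(r < N | I r == i)
      rnorm (b r (ns_val x r)) <= _).
    apply: ler_sum => i _; rewrite (le_trans (ler_rnorm_sum _ _ _))//.
    apply: (@ler_sum_widen _ (fun r => rnorm (b r (ns_val x r))) (fun r => I r == i)) => //.
    by move=> r; exact: rnorm_ge0.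
  rewrite (exchange_big_dep xpredT)//=.
  apply: le_trans (_ : \sum_(r < N) D2 * rnorm (ns_val x r) <= _).
    apply: ler_sum => r _; apply: le_trans (bounded_byE _ (bD r)).
    have [IrN|NIr] := ltnP (I r) N.
      by rewrite (big_pred1 (Ordinal IrN)).
    rewrite big1 ?rnorm_ge0// => i /eqP Iri.
    by move: NIr; rewrite Iri leqNgt ltn_ord.
  by rewrite -mulr_sumr ler_wpM2l// ler_sum_rnorm_ell1.
set V := (fun x : ell1 X => ell1_of _) in V_bd VE.
have Vsingle r u : V (single r u) = single (I r) (b r u).
  apply: ell1_ext => i; rewrite VE singleE; have [->|iIr] := eqVneq i (I r).
    have rIr : (r < (I r).+1)%N by rewrite ltnS leq_id_incr.
    rewrite (big_pred1 (Ordinal rIr)) /=; first by rewrite singleE eqxx.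
    by move=> l /=; rewrite (inj_eq Iinj).
  rewrite big1// => l /eqP Il; rewrite singleE ifF.
    by rewrite linear_map0//; exact: bounded_by_linear (bD l).
  by apply: contraNF iIr => /eqP <-; rewrite Il.
have f_bd := bounded_by_comp U_bd (bounded_by_comp (operator_bounded_by T) V_bd).
have [|g g_bd fg] := @near_identity_invertible _ _ (ell1 X) _ _
    (ell1_geometrically_complete Xc) f_bd.
  apply: (bounded_by_columns _ (bounded_byB f_bd (bounded_by_id _))) => // r u.
  apply: rnorm_ell1_le => N.
  apply: le_trans (_ : \sum_(l < N | l != r :> nat)
      D1 * rnorm (entry T (I l) (I r) (b r u)) <= _).
    rewrite [leRHS]big_mkcond; apply: ler_sum => l _.
    rewrite ns_valB UE Vsingle singleE -/(entry T (I l) (I r) (b r u)).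
    case: eqVneq => [->|_] /=; first by rewrite diag subrr rnorm0.
    by rewrite subr0; exact: bounded_byE.
  rewrite -mulr_sumr; apply: le_trans (ler_wpM2l D10 (off _ _ _)) _.
  by rewrite mulrA ler_wpM2r ?rnorm_ge0.
apply: (factors_throughI U_bd (bounded_by_comp V_bd g_bd)).
  exact: lexx.
exact: fg.
Qed.

Lemma factors_through_le (C D : R) (S T : operator X X) : C <= D ->
  factors_through C S T -> factors_through D S T.
Proof.
by move=> CD [V [U [UTV UVC]]]; exists V, U; split=> //; exact: le_trans CD.
Qed.

Variables (C : R) (J Q : nat -> X -> X).
Hypotheses (J_bd : forall k, bounded_by C (J k))
  (Q_bd : forall k, bounded_by C (Q k)).

(** It suffices that the identity factors through infinitely many of the diagonal
    entries. *)
Lemma factors_diagonal_subsequence (T : operator (ell1 X) (ell1 X))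
    (c e : R) (I k : nat -> nat) :
  geometrically_complete X -> 0 <= c -> 0 <= e -> c * C * e <= 2^-1 ->
  (forall r, (I r < I r.+1)%N) ->
  (forall r L x, \sum_(l < L | l != r :> nat)
    rnorm (entry T (I l) (I r) (J (k r) x)) <= e * rnorm x) ->
  (forall n, exists2 r, (n <= r)%N & exists2 D : operator X X,
    (forall x, D x = Q (k r) (entry T (I r) (I r) (J (k r) x))) &
    factors_through c (id_op X) D) ->
  factors_through (c * C * (C * 2)) (id_op (ell1 X)) T.
Proof.
move=> Xc c0 e0 cCe IS off /incr_subseq[h hS hP].
have /choice[f fP] r : exists p : (X -> X) * (X -> X),
    [/\ bounded_by c p.1, bounded_by 1 p.2 & forall x, p.1 (Q (k (h r))
      (entry T (I (h r)) (I (h r)) (J (k (h r)) (p.2 x)))) = x].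
  have [D DE /(normalized_factorisation c0)[A [B [Ac B1 ADB]]]] := hP r.
  by exists (A, B); split=> // x; rewrite -DE.
have IhS r : (I (h r) < I (h r.+1))%N by exact: homo_ltn_of_succ.
apply: (@factors_almost_diagonal T (c * C) C e
  (fun r x => (f r).1 (Q (k (h r)) x)) (fun r x => J (k (h r)) ((f r).2 x))
  (fun r => I (h r))) => //.
- by move=> r; have [A_bd _ _] := fP r; exact: bounded_by_comp.
- move=> r; have [_ B_bd _] := fP r; rewrite -[C]mulr1.
  exact: bounded_by_comp.
- move=> r L x; have [_ B_bd _] := fP r.
  pose y := (f r).2 x.
  pose w l := if l != h r then rnorm (entry T (I l) (I (h r)) (J (k (h r)) y)) else 0.
  apply: le_trans (_ : \sum_(l < L) w (h l) <= _).
    rewrite big_mkcond /=; apply: ler_sum => l _; rewrite /w.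
    by rewrite (inj_eq (incr_inj hS)).
  apply: (le_trans (@ler_sum_subseq _ w h L _ hS)).
    by move=> i; rewrite /w; case: ifP => // _; exact: rnorm_ge0.
  rewrite -big_mkcond /= (le_trans (off _ _ _))// ler_wpM2l//.
  by rewrite (le_trans (bounded_byE _ B_bd))// mul1r.
- by move=> r x; have [_ _] := fP r; exact.
Qed.

End Factorisation.

Section UPFP_ell1.
Context (R : realType) (s : scalars).
Local Notation K := (scalar_field R s).

Theorem UPFP_ell1_of_non_spreading (X : normedModType K) (C : R)
    (J Q : nat -> X -> X) :
  geometrically_complete X -> non_spreading C J Q -> UPFP X -> UPFP (ell1 X).
Proof.
move=> Xc JQ [c c1 Xpfp]; have [J_bd Q_bd QJ _] := JQ.
have C0 := bounded_by_ge0 (J_bd 0%N).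
have c0 : 0 <= c := le_trans ler01 c1.
exists (Num.max 1 (c * C * (C * 2))) => [|T]; first by rewrite le_max lexx.
pose e := 2^-1 / (c * C + 1).
have cC1 : 0 < c * C + 1 by rewrite ltr_wpDl// mulr_ge0.
have e0 : 0 < e by rewrite divr_gt0.
have cCe : c * C * e <= 2^-1.
  by rewrite mulrCA ler_piMr// ler_pdivrMr// mul1r lerDl.
have T_bd := operator_bounded_by T.
have [I [k [IS off]]] := almost_diagonal JQ e0 (fun j => entry_column j T_bd).
have /choice[D DE] r : exists D : operator X X,
    forall x, D x = Q (k r) (entry T (I r) (I r) (J (k r) x)).
  have := bounded_by_comp (Q_bd (k r)) (bounded_by_comp (bounded_by_coord X (I r))
    (bounded_by_comp T_bd (bounded_by_comp (bounded_by_single X (I r)) (J_bd (k r))))).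
  by move=> /bounded_by_operator[D DE _]; exists D.
have [inf|/existsNP[n0 nfin]] := pselect (forall n, exists2 r, (n <= r)%N &
    factors_through c (id_op X) (D r)).
  left; apply: (@factors_through_le _ _ (ell1 X) (c * C * (C * 2))).
    by rewrite le_max lexx orbT.
  apply: (factors_diagonal_subsequence J_bd Q_bd Xc c0 (ltW e0) cCe IS off).
  by move=> n; have [r nr rP] := inf n; exists r => //; exists (D r).
right; apply: (@factors_through_le _ _ (ell1 X) (c * C * (C * 2))).
  by rewrite le_max lexx orbT.
have entryB i j x : entry (id_op (ell1 X) - T : operator _ _) i j x =
    (if i == j then x else 0) - entry T i j x.
  by rewrite /entry op_funB ns_valB singleE.
apply: (factors_diagonal_subsequence J_bd Q_bd Xc c0 (ltW e0) cCe IS).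
  move=> r L x; apply: le_trans (off r L x); apply: ler_sum => l lr.
  by rewrite entryB (inj_eq (incr_inj IS)) (negbTE lr) sub0r rnormN.
move=> n; exists (maxn n n0); first exact: leq_maxl.
set r := maxn n n0; exists (id_op X - D r).
  move=> x; rewrite op_funB DE entryB eqxx.
  by rewrite linear_mapB ?QJ//; exact: bounded_by_linear (Q_bd _).
have [Dr|//] := Xpfp (D r).
by exfalso; apply: nfin; exists r; [exact: leq_maxr|].
Qed.

End UPFP_ell1.

(** * The decomposition method *)

Section Shifts.
Context (R : realType) (s : scalars).
Local Notation K := (scalar_field R s).

Lemma column_sum_shift (a : nat -> R) N :
  \sum_(n < N) (if (n : nat) is n'.+1 then a n' else 0 : R) = \sum_(n < N.-1) a n.
Proof. by case: N => [|N]; [rewrite !big_ord0|rewrite big_ord_recl add0r]. Qed.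

Variable Y : normedModType K.

Lemma shift_right : exists2 S : ell1 Y -> ell1 Y, bounded_by 1 S &
  forall l n, ns_val (S l) n = if n is n'.+1 then ns_val l n' else 0.
Proof.
have [||Sb SE] := @bounded_by_ell1_of _ _ Y (ell1 Y) 1
  (fun l n => if n is n'.+1 then ns_val l n' else 0) ler01.
- by move=> [|n] a x y //; rewrite scaler0 addr0.
- move=> l N; rewrite mul1r.
  apply: le_trans (ler_sum_rnorm_ell1 l N.-1).
  rewrite -(column_sum_shift (fun n => rnorm (ns_val l n))); apply: ler_sum => -[[|n] nN] _ //=.
  by rewrite rnorm0.
- by eexists; [exact: Sb|move=> l n; rewrite SE].
Qed.

Lemma shift_left : exists2 S : ell1 Y -> ell1 Y, bounded_by 1 S &
  forall l n, ns_val (S l) n = ns_val l n.+1.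
Proof.
have [||Sb SE] := @bounded_by_ell1_of _ _ Y (ell1 Y) 1
  (fun l n => ns_val l n.+1) ler01.
- by move=> n a x y.
- move=> l N; rewrite mul1r; apply: le_trans (ler_sum_rnorm_ell1 l N.+1).
  by rewrite big_ord_recl lerDr rnorm_ge0.
- by eexists; [exact: Sb|move=> l n; rewrite SE].
Qed.

Lemma diagonal_map M (f : Y -> Y) : bounded_by M f ->
  exists2 S : ell1 Y -> ell1 Y, bounded_by M S &
  forall l n, ns_val (S l) n = f (ns_val l n).
Proof.
move=> fM; have [||Sb SE] := @bounded_by_ell1_of _ _ Y (ell1 Y) M
  (fun l n => f (ns_val l n)) (bounded_by_ge0 fM).
- by move=> n a x y /=; rewrite (bounded_by_linear fM).
- move=> l N; apply: le_trans (_ : \sum_(i < N) M * rnorm (ns_val l i) <= _).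
    by apply: ler_sum => i _; exact: bounded_byE.
  by rewrite -mulr_sumr ler_wpM2l ?(bounded_by_ge0 fM) ?ler_sum_rnorm_ell1.
- by eexists; [exact: Sb|move=> l n; rewrite SE].
Qed.

(** Pelczynski's decomposition: if [Y] is isomorphic to [ell1 Y], and [Y], [Z]
    are each isomorphic to a complemented subspace of the other, then [Z] and
    [Y] are isomorphic.  The isomorphism is the composition of
    [Z ~ Z (+) ell1 Y] and [Z (+) ell1 Y ~ ell1 Y ~ Y]. *)
Lemma decomposition (Z : normedModType K) Mi Mr Ma Mb
    (i : Z -> Y) (r : Y -> Z) (a : Y -> Z) (b : Z -> Y) :
  isomorphic Y (ell1 Y) ->
  bounded_by Mi i -> bounded_by Mr r -> bounded_by Ma a -> bounded_by Mb b ->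
  (forall z, r (i z) = z) -> (forall y, b (a y) = y) -> isomorphic Z Y.
Proof.
move=> [sg [tau [sgK tauK]]] ib rb ab bb ri ba.
have sgb := operator_bounded_by sg; have taub := operator_bounded_by tau.
have li := bounded_by_linear ib; have la := bounded_by_linear ab.
have lb := bounded_by_linear bb; have lr := bounded_by_linear rb.
have lsg := bounded_by_linear sgb; have ltau := bounded_by_linear taub.
(* [e] and [g] are the projections onto the copy of [Z] in [Y] and onto its
   complement; [e] is kept abstract so that only its equations are used *)
have [e eE] : exists e : Y -> Y, forall y, e y = i (r y) by exists (i \o r).
have [g gE] : exists g : Y -> Y, forall y, g y = y - e y.
  by exists (fun y => y - e y).
have e_bd : bounded_by (Mi * Mr) e.
  by apply: eq_bounded_by (bounded_by_comp ib rb) => y; rewrite eE.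
have g_bd : bounded_by (1 + Mi * Mr) g.
  by apply: eq_bounded_by (bounded_byB (bounded_by_id Y) e_bd) => y; rewrite gE.
have eD := linear_mapD (bounded_by_linear e_bd).
have gD := linear_mapD (bounded_by_linear g_bd).
have ei z : e (i z) = i z by rewrite eE ri.
have ee y : e (e y) = e y by rewrite !eE ri.
have gi z : g (i z) = 0 by rewrite gE ei subrr.
have ge y : g (e y) = 0 by rewrite gE ee subrr.
have rg y : r (g y) = 0 by rewrite gE linear_mapB// eE ri subrr.
have eg y : e (g y) = 0 by rewrite eE rg linear_map0.
have gg y : g (g y) = g y by rewrite [LHS]gE eg subr0.
have geE y : g y + e y = y by rewrite gE subrK.
have [shr shrb shrE] := shift_right; have [shl shlb shlE] := shift_left.
have [de deb deE] := diagonal_map e_bd.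
have [dg dgb dgE] := diagonal_map g_bd.
have c0b := bounded_by_coord Y 0%N.
have s0b := bounded_by_single Y 0%N.
(* [z |-> (p z, q z)] is the isomorphism of [Z] with [Z (+) ell1 Y], and [w z] is
   the image of this pair in [ell1 Y]; primes denote the inverse maps *)
pose p z := z - a (b z) + a (ns_val (sg (b z)) 0%N).
pose q z := shl (sg (b z)).
pose w z := single 0 (i (p z)) + dg (q z) + shr (de (q z)).
pose p' y := r (ns_val (sg y) 0%N).
pose q' y := dg (sg y) + shl (de (sg y)).
pose z' y := p' y - a (b (p' y)) + a (tau (single 0 (b (p' y)) + shr (q' y))).
have p_bd := bounded_byD (bounded_byB (bounded_by_id Z) (bounded_by_comp ab bb))
  (bounded_by_comp ab (bounded_by_comp c0b (bounded_by_comp sgb bb))).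
have q_bd := bounded_by_comp shlb (bounded_by_comp sgb bb).
have w_bd := bounded_byD (bounded_byD (bounded_by_comp s0b (bounded_by_comp ib p_bd))
  (bounded_by_comp dgb q_bd)) (bounded_by_comp shrb (bounded_by_comp deb q_bd)).
have p'_bd := bounded_by_comp rb (bounded_by_comp c0b sgb).
have q'_bd := bounded_byD (bounded_by_comp dgb sgb)
  (bounded_by_comp shlb (bounded_by_comp deb sgb)).
have z'_bd := bounded_byD (bounded_byB p'_bd (bounded_by_comp ab (bounded_by_comp bb p'_bd)))
  (bounded_by_comp ab (bounded_by_comp taub (bounded_byD
    (bounded_by_comp s0b (bounded_by_comp bb p'_bd)) (bounded_by_comp shrb q'_bd)))).
have w0 z : ns_val (w z) 0%N = i (p z) + g (ns_val (q z) 0%N).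
  by rewrite /w !ns_valD singleE shrE dgE addr0.
have wS z n : ns_val (w z) n.+1 = g (ns_val (q z) n.+1) + e (ns_val (q z) n).
  by rewrite /w !ns_valD singleE shrE dgE deE add0r.
have p'w z : p' (tau (w z)) = p z.
  by rewrite /p' tauK w0 linear_mapD// ri rg addr0.
have q'w z : q' (tau (w z)) = q z.
  apply: ell1_ext => -[|n]; rewrite /q' tauK ns_valD dgE shlE deE ?w0 !wS.
    by rewrite !gD !eD gi gg eg ee !add0r geE.
  by rewrite !gD !eD gg ge eg ee add0r addr0 geE.
have sg_split (l : ell1 Y) : single 0 (ns_val l 0%N) + shr (shl l) = l.
  apply: ell1_ext => -[|n]; rewrite ns_valD singleE shrE ?addr0//.
  by rewrite shlE add0r.
have bp z : b (p z) = ns_val (sg (b z)) 0%N.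
  by rewrite /p linear_mapD// linear_mapB// !ba subrr add0r.
apply: (isomorphicI (f := fun z => tau (w z)) (g := z')).
- exact: bounded_by_comp taub w_bd.
- exact: z'_bd.
- move=> z; rewrite /z' p'w q'w bp sg_split sgK /p.
  by rewrite addrK subrK.
- move=> y; rewrite -[RHS]sgK; congr (tau _).
  set t := single 0 (b (p' y)) + shr (q' y).
  have bz : b (z' y) = tau t.
    by rewrite /z' linear_mapD// linear_mapB// !ba subrr add0r.
  have pz : p (z' y) = p' y.
    rewrite /p bz tauK {2}/t ns_valD singleE shrE addr0.
    by rewrite /z' -/t addrK subrK.
  have qz : q (z' y) = q' y.
    apply: ell1_ext => n; rewrite /q bz tauK shlE /t ns_valD singleE shrE.
    by rewrite add0r.
  apply: ell1_ext => -[|n]; rewrite ?w0 ?wS ?pz qz /q' !ns_valD !dgE !shlE !deE.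
    by rewrite /p' -eE !gD gg ge addr0 addrC geE.
  by rewrite !gD !eD gg !ge eg ee addr0 add0r geE.
Qed.

End Shifts.

Section Ell1Square.
Context (R : realType) (s : scalars).
Local Notation K := (scalar_field R s).

Lemma rnorm_ell1_esum (X : normedModType K) (x : ell1 X) :
  (rnorm x)%:E = (\esum_(n in [set: nat]) (rnorm (ns_val x n))%:E)%E.
Proof.
have -> : rnorm x = fine (lp_norm 1%E (ns_val x)) by exact: rnorm_ell.
have xoo : (lp_norm 1%E (ns_val x) < +oo)%E by exact: (ns_valE x).
rewrite fineK ?ge0_fin_numE ?lp_norm_ge0// lp_norm1E nneseries_esumT// => n.
by rewrite lee_fin rnorm_ge0.
Qed.

Lemma ler_sum_esum (f : nat -> R) M : (forall n, 0 <= f n) ->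
  (\esum_(n in [set: nat]) (f n)%:E <= M%:E)%E ->
  forall N, \sum_(n < N) f n <= M.
Proof.
move=> f0 fM N; rewrite -lee_fin -sumEFin (le_trans _ fM)//.
rewrite -nneseries_esumT => [|n]; last by rewrite lee_fin.
rewrite -(big_mkord predT (fun n => (f n)%:E)).
by apply: nneseries_lim_ge => n _ _; rewrite lee_fin.
Qed.

Lemma esum_nat2 (e : nat * nat -> nat) (a : nat -> nat * nat) (f : nat -> nat -> \bar R) :
  cancel a e -> cancel e a -> (forall n i, 0 <= f n i)%E ->
  (\esum_(n in [set: nat]) \esum_(i in [set: nat]) f n i =
   \esum_(j in [set: nat]) f (a j).1 (a j).2)%E.
Proof.
move=> ae ea f0; rewrite (@esum_esum _ _ _ [set: nat] (fun=> [set: nat]))//.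
rewrite (reindex_esum [set: nat] _ a)//; split=> //.
- by move=> i j _ _; exact: (can_inj ae).
- by move=> k _; exists (e k).
Qed.

(** Grouping the coordinates along a bijection of [nat] with [nat * nat]. *)
Lemma isomorphic_ell1_ell1 (X : normedModType K) :
  isomorphic (ell1 X) (ell1 (ell1 X)).
Proof.
have [e [a [ae ea]]] : exists (e : nat * nat -> nat) (a : nat -> nat * nat),
    cancel a e /\ cancel e a.
  have /card_set_bijP[e [_ einj esurj]] := card_nat2.
  have /choice[a aK] j : exists p, e p = j.
    by have [p _ pj] := esurj j I; exists p.
  exists e, a; split=> // p; apply: einj; rewrite ?inE//; exact: aK.
pose row (x : ell1 X) n : ell1 X := ell1_of (fun i => ns_val x (e (n, i))).
have esum_x (x : ell1 X) : (\esum_(n in [set: nat]) \esum_(i in [set: nat])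
    (rnorm (ns_val x (e (n, i))))%:E = (rnorm x)%:E)%E.
  rewrite (esum_nat2 ae ea); last by move=> *; rewrite lee_fin rnorm_ge0.
  rewrite rnorm_ell1_esum; apply: eq_esum => j _.
  by rewrite -surjective_pairing ae.
have rowE x n : ns_val (row x n) = fun i => ns_val x (e (n, i)).
  apply: (@ell1_ofE _ _ _ _ (rnorm x)).
  apply: (@ler_sum_esum (fun i => rnorm (ns_val x (e (n, i))))) => [i|].
    exact: rnorm_ge0.
  rewrite -esum_x.
  apply: esum_ge; exists [set n]%classic; first by split.
  by rewrite fsbig_set1.
have esum_row x : (\esum_(n in [set: nat]) (rnorm (row x n))%:E = (rnorm x)%:E)%E.
  rewrite -esum_x; apply: eq_esum => n _.
  by rewrite rnorm_ell1_esum; apply: eq_esum => i _; rewrite rowE.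
have [||f_bd fE] := @bounded_by_ell1_of _ _ (ell1 X) (ell1 X) 1 row ler01.
- by move=> n c x y; apply: ell1_ext => i; rewrite ns_val_lin !rowE.
- move=> x N; rewrite mul1r.
  apply: (@ler_sum_esum (fun n => rnorm (row x n))) => [n|]; first exact: rnorm_ge0.
  by rewrite esum_row.
pose flat (y : ell1 (ell1 X)) j := ns_val (ns_val y (a j).1) (a j).2.
have [||g_bd gE] := @bounded_by_ell1_of _ _ X (ell1 (ell1 X)) 1 flat ler01.
- by move=> j c x y; rewrite /flat !ns_val_lin.
- move=> y N; rewrite mul1r.
  apply: (@ler_sum_esum (fun j => rnorm (flat y j))) => [n|]; first exact: rnorm_ge0.
  rewrite rnorm_ell1_esum.
  rewrite -(esum_nat2 (f := fun n i => (rnorm (ns_val (ns_val y n) i))%:E) ae ea);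
    last first.
    by move=> *; rewrite lee_fin rnorm_ge0.
  by apply: le_esum => n _; rewrite rnorm_ell1_esum.
apply: (isomorphicI f_bd g_bd) => [x|y].
- apply: ell1_ext => j; rewrite gE /flat fE rowE.
  by rewrite -surjective_pairing ae.
- apply: ell1_ext => n; rewrite fE; apply: ell1_ext => i.
  by rewrite rowE gE /flat ea.
Qed.

Lemma UPFP_isomorphic (X Y : normedModType K) :
  isomorphic X Y -> UPFP X -> UPFP Y.
Proof.
move=> [F [G [FG GF]]] [c c1 pfp].
have Fb := operator_bounded_by F; have Gb := operator_bounded_by G.
have lG := bounded_by_linear Gb.
exists (Num.max 1 (rnorm F ^+ 2 * rnorm G ^+ 2 * c)) => [|T].
  by rewrite le_max lexx.
have transfer (S : operator X X) (T' : operator Y Y) :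
    (forall x, S x = G (T' (F x))) -> factors_through c (id_op X) S ->
    factors_through (Num.max 1 (rnorm F ^+ 2 * rnorm G ^+ 2 * c)) (id_op Y) T'.
  move=> SE /factors_throughP[V [U [a [b [Ua Vb abc USV]]]]].
  apply: (factors_throughI (U := fun y => F (U (G y))) (V := fun y => F (V (G y)))).
  - exact: bounded_by_comp Fb (bounded_by_comp Ua Gb).
  - exact: bounded_by_comp Fb (bounded_by_comp Vb Gb).
  - rewrite le_max; apply/orP; right.
    rewrite [leLHS](_ : _ = rnorm F ^+ 2 * rnorm G ^+ 2 * (a * b)); last by ring.
    by rewrite ler_wpM2l// mulr_ge0// sqr_ge0.
  - by move=> y; rewrite -SE USV /= GF.
have [S SE _] := bounded_by_operator
  (bounded_by_comp Gb (bounded_by_comp (operator_bounded_by T) Fb)).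
have [/(transfer _ T SE)|/(transfer _ (id_op Y - T))] := pfp S; first by left.
by move=> h; right; apply: h => x; rewrite !op_funB SE linear_mapB//= FG.
Qed.

Lemma isomorphic_range (Y : normedModType K) (c : R) (P : operator Y Y) :
  isomorphic Y (ell1 Y) -> P \o P =1 P -> factors_through c (id_op Y) P ->
  isomorphic (op_range P) Y.
Proof.
move=> Yell PP /factors_throughP[V [U [ca [cb [Ub Vb _ UPV]]]]].
have Pb := operator_bounded_by P.
pose r (y : Y) : op_range P := insubd (0 : nspace (op_range_ns P)) (P y).
have rE y : ns_val (r y) = P y.
  by rewrite /r insubdK//; apply/asboolP; exists y.
have rangeE (z : op_range P) : P (ns_val z) = ns_val z.
  by have [y _ <-] := ns_valE z; exact: PP.
have rn (z : op_range P) : rnorm z = rnorm (ns_val z) by exact: rnorm_nspace.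
have i_bd : bounded_by 1 (fun z : op_range P => ns_val z).
  by split=> // z; rewrite mul1r rn.
have r_bd : bounded_by (rnorm P) r.
  split=> [a x y||y]; [|exact: rnorm_ge0|by rewrite rn rE; exact: bounded_byE].
  by apply: val_inj; rewrite /= !rE (bounded_by_linear Pb).
apply: (decomposition Yell i_bd r_bd (bounded_by_comp r_bd Vb)
  (bounded_by_comp Ub i_bd)).
- by move=> z; apply: val_inj; rewrite /= rE rangeE.
- by move=> y; rewrite /= rE UPV.
Qed.

Theorem UPFP_ell1_primary (X : normedModType K) : UPFP (ell1 X) ->
  primary (ell1 X).
Proof.
move=> [c _ pfp] P PP; have lP := bounded_by_linear (operator_bounded_by P).
have [h|h] := pfp P; [left|right]; apply: (isomorphic_range _ _ h) => //.
- exact: isomorphic_ell1_ell1.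
- exact: isomorphic_ell1_ell1.
have E y : op_fun (id_op (ell1 X) - P) y = y - P y by [].
move=> x; rewrite /comp !E (linear_mapB lP).
have PPx : P (P x) = P x := PP x.
by rewrite PPx subrr subr0.
Qed.

End Ell1Square.

(** * Spaces isomorphic to a sequence space over themselves *)

Section Signs.
Context (R : realType) (s : scalars).
Local Notation K := (scalar_field R s).
Variable X : normedModType K.

Lemma ler_sum_blocks (f : nat -> R) (F : nat -> pred nat) n N :
  (forall i, 0 <= f i) -> (forall i m m', F m i -> F m' i -> m = m') ->
  \sum_(m < n) \sum_(i < N | F m i) f i <= \sum_(i < N) f i.
Proof.
move=> f0 Fdisj; rewrite (exchange_big_dep xpredT)//=; apply: ler_sum => i _.
have [[m Fmi]|noF] := pselect (exists m : 'I_n, F m i); last first.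
  by rewrite big1// => m Fmi; exfalso; apply: noF; exists m.
rewrite (big_pred1 m)// => m' /=; apply/idP/eqP => [Fm'i|->//].
by apply: val_inj; exact: Fdisj Fm'i Fmi.
Qed.

Lemma card_signs n : (#|{ffun 'I_n -> bool}|%:R = 2 ^+ n :> R).
Proof. by rewrite card_ffun card_bool card_ord natrX. Qed.

(** A vector is dominated by the average of the norms of the signed sums
    containing it. *)
Lemma ler_average_signs n (y : 'I_n -> X) j :
  2 ^+ n * rnorm (y j) <=
  \sum_(e : {ffun 'I_n -> bool}) rnorm (\sum_(m < n) (-1) ^+ e m *: y m).
Proof.
pose S (e : {ffun 'I_n -> bool}) := \sum_(m < n) (-1) ^+ e m *: y m.
(* [flip] changes all the signs except the one of [y j] *)
pose flip (e : {ffun 'I_n -> bool}) := [ffun m => if m == j then e m else ~~ e m].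
have flipK : involutive flip.
  by move=> e; apply/ffunP => m; rewrite !ffunE; case: eqP => //; rewrite negbK.
rewrite -/(S _) -(ler_pM2l (_ : 0 < 2))// [leRHS]mulr_natl mulr2n.
rewrite [X in _ <= X + _](reindex_inj (inv_inj flipK)) /= -big_split /=.
apply: le_trans (_ : \sum_(e : {ffun 'I_n -> bool}) 2 * rnorm (y j) <= _).
  by rewrite sumr_const -[leRHS]mulr_natl card_signs mulrCA.
apply: ler_sum => e _; apply: le_trans (ler_rnormD _ _).
have -> : \sum_(m < n) (-1) ^+ flip e m *: y m + \sum_(m < n) (-1) ^+ e m *: y m
    = (-1) ^+ e j *: y j *+ 2.
  rewrite -big_split (bigD1 j)//= big1 ?addr0.
    by rewrite ffunE eqxx mulr2n.
  move=> m mj; rewrite ffunE (negbTE mj).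
  by case: (e m); rewrite expr1 expr0 scaleN1r scale1r ?addNr ?addrN.
rewrite -scaler_nat rnormZ rnorm_sign ler_wpM2r ?rnorm_ge0//.
have -> : (2%:R : K) = of_real s 2.
  by rewrite -[2 in RHS]/(1 + 1) of_realD of_real1.
by rewrite rabs_of_real.
Qed.

(** If all signed sums of [n] sequences have norm at most [B] in [ell1 X], then
    the sum of the norms of their restrictions to disjoint blocks of coordinates
    is at most [B]. *)
Lemma ler_blocks_signs n N (z : nat -> nat -> X) (F : nat -> pred nat) B :
  (forall i m m', F m i -> F m' i -> m = m') ->
  (forall e : {ffun 'I_n -> bool},
    \sum_(i < N) rnorm (\sum_(m < n) (-1) ^+ e m *: z m i) <= B) ->
  \sum_(m < n) \sum_(i < N | F m i) rnorm (z m i) <= B.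
Proof.
move=> Fdisj zB; have n2 : 0 < 2 ^+ n :> R by rewrite exprn_gt0.
rewrite -(ler_pM2l n2) mulr_sumr.
apply: le_trans (_ : \sum_(m < n) \sum_(i < N | F m i)
   \sum_(e : {ffun 'I_n -> bool}) rnorm (\sum_(m' < n) (-1) ^+ e m' *: z m' i) <= _).
  apply: ler_sum => m _; rewrite mulr_sumr; apply: ler_sum => i _.
  exact: (ler_average_signs (fun m' : 'I_n => z m' i)).
under eq_bigr do rewrite exchange_big /=.
rewrite exchange_big /= -card_signs mulr_natl -sumr_const.
apply: ler_sum => e _; apply: le_trans (zB e).
by apply: (@ler_sum_blocks (fun i => rnorm (\sum_(m' < n) (-1) ^+ e m' *: z m' i)))
  => // i; exact: rnorm_ge0.
Qed.

(** In the definition of [non_spreading] it suffices to consider vectors of the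
    unit ball. *)
Lemma non_spreadingI (C : R) (J Q : nat -> X -> X) :
  (forall k, bounded_by C (J k)) -> (forall k, bounded_by C (Q k)) ->
  (forall k x, Q k (J k x) = x) ->
  (forall M d : R, 0 < d -> exists n, forall t, column M t ->
    forall N (F : nat -> pred nat) (k : nat -> nat) (x : nat -> X),
    (forall i m m', F m i -> F m' i -> m = m') -> injective k ->
    (forall m, rnorm (x m) <= 1) ->
    ~ (forall m, (m < n)%N ->
       d < \sum_(i < N | F m i) rnorm (t i (J (k m) (x m))))) ->
  non_spreading C J Q.
Proof.
move=> Jb Qb QJ small; split=> // M d d0; have [n nP] := small M d d0.
exists n => t tM N F k x Fdisj kinj.
pose y m := of_real s (rnorm (x m))^-1 *: x m.
have y1 m : rnorm (y m) <= 1.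
  rewrite rnormZ rabs_of_real ?invr_ge0 ?rnorm_ge0//.
  have [->|x0] := eqVneq (rnorm (x m)) 0; first by rewrite mulr0.
  by rewrite mulVf.
have xE m : x m = of_real s (rnorm (x m)) *: y m.
  have [x0|x0] := eqVneq (rnorm (x m)) 0.
    by rewrite x0 of_real0 scale0r (rnorm0_eq0 x0).
  by rewrite scalerA -of_realM mulfV// of_real1 scale1r.
apply: contrapT => big; apply: (nP t tM N F k y Fdisj kinj y1).
move=> m mn; rewrite ltNge; apply/negP => dm; apply: big; exists m => //.
rewrite [leLHS](_ : _ = rnorm (x m) * \sum_(i < N | F m i) rnorm (t i (J (k m) (y m)))).
  by rewrite mulrC ler_wpM2r ?rnorm_ge0.
rewrite mulr_sumr; apply: eq_bigr => i _.
rewrite {1}xE (linear_mapZ (bounded_by_linear (Jb _))) (linear_mapZ (tM.1 i)).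
by rewrite rnormZ rabs_of_real// rnorm_ge0.
Qed.

(** If [X] is isomorphic to a space [E] with coordinate copies of [X], in which
    the norm of a sum of [n] coordinate vectors grows slower than [n], then
    operators from [X] to [ell1 X] cannot spread these copies. *)
Lemma non_spreading_coordinates (E : normedModType K)
    (inj : nat -> X -> E) (pr : nat -> E -> X) :
  isomorphic X E -> (forall k, bounded_by 1 (inj k)) ->
  (forall k, bounded_by 1 (pr k)) -> (forall k x, pr k (inj k x) = x) ->
  (forall h, 0 < h -> exists n, forall (k : nat -> nat) (x : nat -> X),
    injective k -> (forall m, rnorm (x m) <= 1) ->
    rnorm (\sum_(m < n) inj (k m) (x m)) < h * n%:R) ->
  exists C J Q, non_spreading (X := X) C J Q.
Proof.
move=> [f [g [fg gf]]] injb prb prinj growth.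
have fb := operator_bounded_by f; have gb := operator_bounded_by g.
have lg := bounded_by_linear gb.
exists (rnorm f + rnorm g), (fun k x => g (inj k x)), (fun k x => pr k (f x)).
apply: non_spreadingI => [k|k|k x|M d d0].
- apply: bounded_by_le (bounded_by_comp gb (injb k)).
  by rewrite mulr1 lerDr rnorm_ge0.
- apply: bounded_by_le (bounded_by_comp (prb k) fb).
  by rewrite mul1r lerDl rnorm_ge0.
- by rewrite gf prinj.
set c := `|M| * rnorm g.
have c0 : 0 <= c by rewrite mulr_ge0 ?rnorm_ge0.
have c1 : 0 < c + 1 by rewrite ltr_wpDl.
(* [c] bounds the composition of the isomorphism with an operator of norm [M],
   so that signed sums of [n] images have norm less than [d * n]. *)
have [n nP] := growth (d / (c + 1)) (divr_gt0 d0 c1).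
exists n => t [tlin tM] N F k x Fdisj kinj x1.
have n0 : 0 < n%:R :> R.
  have := nP k x kinj x1; rewrite ltNge => /negP u; rewrite ltNge; apply/negP => n0.
  by apply: u; apply: le_trans (rnorm_ge0 _); rewrite pmulr_rle0 ?divr_gt0.
move=> large; have : d * n%:R < \sum_(m < n) \sum_(i < N | F m i)
    rnorm (t i (g (inj (k m) (x m)))).
  apply: le_lt_trans (_ : \sum_(m < n) d < _).
    by rewrite sumr_const card_ord -[leRHS]mulr_natr.
  apply: ltr_sum => [|m _]; last exact: large.
  by rewrite has_predT /index_enum -enumT size_enum_ord -(ltr0n R).
apply/negP; rewrite -leNgt.
apply: (@ler_blocks_signs n N (fun m i => t i (g (inj (k m) (x m)))) F) => // e.
pose v (m : nat) : X := if insub m is Some m' then (-1) ^+ e m' *: x m' else 0.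
have vE (m : 'I_n) : v m = (-1) ^+ e m *: x m by rewrite /v valK.
have v1 m : rnorm (v m) <= 1.
  by rewrite /v; case: insub => [m'|]; rewrite ?rnorm_sign ?rnorm0 ?ler01.
have sumE i : \sum_(m < n) (-1) ^+ e m *: t i (g (inj (k m) (x m))) =
    t i (g (\sum_(m < n) inj (k m) (v m))).
  rewrite (linear_map_sum lg) (linear_map_sum (tlin i)).
  apply: eq_bigr => m _; rewrite vE (linear_mapZ (bounded_by_linear (injb _))).
  by rewrite (linear_mapZ lg) (linear_mapZ (tlin i)).
under eq_bigr do rewrite sumE.
apply: le_trans (tM _ N) _.
have vn := nP k v kinj v1; set u := \sum_(m < n) _ in vn *.
apply: le_trans (_ : (c + 1) * rnorm u <= _); last first.
  rewrite (le_trans (ler_wpM2l (ltW c1) (ltW vn)))//.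
  by rewrite mulrA mulrCA mulfV ?mulr1 ?gt_eqF.
apply: le_trans (_ : c * rnorm u <= _); last by rewrite ler_wpM2r ?rnorm_ge0 ?lerDl.
rewrite /c -mulrA; apply: le_trans (ler_wpM2r (rnorm_ge0 _) (ler_norm M)) _.
by rewrite ler_wpM2l// bounded_byE.
Qed.

End Signs.

Section SequenceSpaces.
Context (R : realType) (s : scalars).
Local Notation K := (scalar_field R s).
Variable X : normedModType K.

(** The sequence with [x] at position [k] and [0] elsewhere, before it is seen as
    an element of a particular sequence space. *)
Definition delta (k : nat) (x : X) : nat -> X := fun i => if i == k then x else 0.

(** The criterion [non_spreading_coordinates] for a normed space of sequences. *)
Lemma non_spreading_nspace (ns : normed_subspace (nat -> X)) :
  isomorphic X (nspace ns) ->
  (forall x, ns_set ns x -> forall i, rnorm (x i) <= ns_norm ns x) ->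
  (forall k x, ns_set ns (delta k x) /\ ns_norm ns (delta k x) <= rnorm x) ->
  (forall h, 0 < h -> exists n, forall (k : nat -> nat) (x : nat -> X),
    injective k -> (forall m, rnorm (x m) <= 1) ->
    ns_norm ns (fun i => \sum_(m < n) delta (k m) (x m) i) < h * n%:R) ->
  exists C J Q, non_spreading (X := X) C J Q.
Proof.
move=> iso coord single_norm growth.
pose inj k x : nspace ns := insubd (0 : nspace ns) (delta k x).
have injE k x : ns_val (inj k x) = delta k x.
  by rewrite /inj insubdK//; apply/asboolP; exact: (single_norm k x).1.
have val_sum n (y : nat -> nspace ns) i :
    ns_val (\sum_(m < n) y m) i = \sum_(m < n) ns_val (y m) i.
  exact: (big_morph (fun x : nspace ns => ns_val x i)).
apply: (non_spreading_coordinates iso (inj := inj)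
  (pr := fun k (y : nspace ns) => ns_val y k)).
- move=> k; split=> // [a x y|x].
    apply: val_inj; rewrite [LHS]injE; apply/funext => i.
    rewrite [RHS](_ : _ = a *: ns_val (inj k x) i + ns_val (inj k y) i)// !injE.
    by rewrite /delta; case: eqP => _ //; rewrite scaler0 addr0.
  by rewrite mul1r rnorm_nspace injE; exact: (single_norm k x).2.
- move=> k; split=> // y; rewrite mul1r rnorm_nspace.
  exact/coord/ns_valE.
- by move=> k x; rewrite injE /delta eqxx.
- move=> h h0; have [n nP] := growth h h0; exists n => k x kinj x1.
  rewrite rnorm_nspace (_ : ns_val _ = fun i => \sum_(m < n) delta (k m) (x m) i).
    exact: nP.
  apply/funext => i; rewrite (val_sum n (fun m => inj (k m) (x m))).
  by apply: eq_bigr => m _; rewrite injE.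
Qed.

Lemma lp_norm_le (r : R) (y : nat -> X) B : 0 < r -> 0 <= B ->
  (forall N, \sum_(i < N) rnorm (y i) `^ r <= B) ->
  (lp_norm r%:E y <= (B `^ r^-1)%:E)%E.
Proof.
move=> r0 B0 yB; rewrite lp_normE// -poweR_EFin.
have S0 : (0 <= \sum_(n <oo) (rnorm (y n) `^ r)%:E)%E.
  by apply: nneseries_ge0 => n _ _; rewrite lee_fin powR_ge0.
apply: gt0_ler_poweR.
- by rewrite invr_ge0 ltW.
- by rewrite in_itv/= leey andbT.
- by rewrite in_itv/= leey andbT lee_fin.
apply: lime_le; first by apply: is_cvg_nneseries => n _ _; rewrite lee_fin powR_ge0.
by apply: nearW => N; rewrite big_mkord sumEFin lee_fin.
Qed.

Lemma lp_normy_le (y : nat -> X) B : (forall i, rnorm (y i) <= B) ->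
  (lp_norm +oo y <= B%:E)%E.
Proof.
by move=> yB; rewrite lp_normyE; apply: ge_ereal_sup => _ [i _ <-]; rewrite lee_fin.
Qed.

Lemma sum_delta_le1 n (k : nat -> nat) (x : nat -> X) i :
  injective k -> (forall m, rnorm (x m) <= 1) ->
  rnorm (\sum_(m < n) delta (k m) (x m) i) <= 1.
Proof.
move=> kinj x1; have [[m im]|no] := pselect (exists m : 'I_n, i = k m).
  rewrite (bigD1 m)//= {1}/delta im eqxx big1 ?addr0// => m' m'm.
  rewrite /delta (inj_eq kinj) ifF//.
  by apply: contraNF m'm => /eqP e; apply/eqP/val_inj.
rewrite big1 ?rnorm0// => m _; rewrite /delta ifF//.
by apply/negP => /eqP im; apply: no; exists m.
Qed.

(** Sublinear growth of [n `^ r^-1]; this is where [p > 1] is needed. *)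
Lemma powR_sublinear (r h : R) : 1 < r -> 0 < h ->
  exists n : nat, n%:R `^ r^-1 < h * n%:R.
Proof.
move=> r1 h0; have r0 : 0 < r by exact: lt_trans r1.
pose a : R := 1 - r^-1.
have a0 : 0 < a by rewrite subr_gt0 invf_lt1.
pose n := (Num.truncn (h^-1 `^ a^-1)).+1.
have hn : h^-1 `^ a^-1 < n%:R by exact: truncnS_gt.
exists n; have n0 : 0 < n%:R :> R by rewrite ltr0n.
have : h^-1 < n%:R `^ a.
  have -> : h^-1 = (h^-1 `^ a^-1) `^ a.
    by rewrite -powRrM mulVf ?lt0r_neq0// powRr1// invr_ge0 ltW.
  by apply: gt0_ltr_powR; rewrite // nnegrE ?powR_ge0 ?ler0n.
rewrite /a powRB; last by rewrite lt0r_neq0 ?implybT.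
rewrite powRr1 ?ltW//.
by rewrite ltr_pdivlMr ?powR_gt0// ltr_pdivrMl.
Qed.

Lemma non_spreading_ell (p : \bar R) (p1 : (1 <= p)%E) : (1 < p)%E ->
  isomorphic X (ell X p1) -> exists C J Q, non_spreading (X := X) C J Q.
Proof.
move=> p_gt1 iso; apply: (non_spreading_nspace (ns := ell_ns X p1)) => //=.
- move=> x xp i; rewrite -lee_fin fineK ?le_lp_norm//.
  by rewrite ge0_fin_numE ?lp_norm_ge0.
- suff fin k x : (lp_norm p (delta k x) <= (rnorm x)%:E)%E.
    move=> k x; split; first exact: le_lt_trans (fin k x) (ltry _).
    rewrite -lee_fin fineK// ge0_fin_numE ?lp_norm_ge0//.
    exact: le_lt_trans (fin k x) (ltry _).
  case: p p1 p_gt1 {iso} => [r|_ _|//]; last first.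
    apply: lp_normy_le => i; rewrite /delta; case: ifP => // _.
    by rewrite rnorm0 rnorm_ge0.
  rewrite !lte_fin => r1' r1; have r0 : 0 < r by exact: lt_trans r1.
  have -> : (rnorm x)%:E = ((rnorm x `^ r) `^ r^-1)%:E.
    by rewrite -powRrM mulfV ?gt_eqF// powRr1// rnorm_ge0.
  apply: lp_norm_le => //; first exact: powR_ge0.
  move=> N; have [kN|Nk] := ltnP k N.
    rewrite (bigD1 (Ordinal kN))//= /delta eqxx big1 ?addr0// => i.
    by rewrite -val_eqE /= => /negbTE ->; rewrite rnorm0 powR0 ?gt_eqF.
  rewrite big1 ?powR_ge0// => i _; rewrite /delta ltn_eqF.
    by rewrite rnorm0 powR0 ?gt_eqF.
  exact: leq_trans (ltn_ord i) Nk.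
- move=> h h0.
  suff [n nP] : exists n, exists2 B, B < h * n%:R & forall (k : nat -> nat) (x : nat -> X),
      injective k -> (forall m, rnorm (x m) <= 1) ->
      (lp_norm p (fun i => \sum_(m < n) delta (k m) (x m) i)%R <= B%:E)%E.
    have [B Bn nB] := nP; exists n => k x kinj x1; apply: le_lt_trans Bn.
    have := nB k x kinj x1 => yB.
    rewrite -lee_fin fineK// ge0_fin_numE ?lp_norm_ge0//.
    exact: le_lt_trans yB (ltry _).
  case: p p1 p_gt1 {iso} => [r|_ _|//]; last first.
    exists (Num.truncn h^-1).+1, 1.
      by rewrite -ltr_pdivrMl// mulr1 truncnS_gt.
    by move=> k x kinj x1; apply: lp_normy_le => i; exact: sum_delta_le1.
  rewrite !lte_fin => r1' r1; have r0 : 0 < r by exact: lt_trans r1.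
  have [n nh] := powR_sublinear r1 h0; exists n, (n%:R `^ r^-1) => // k x kinj x1.
  apply: lp_norm_le => // N.
  apply: le_trans (_ : \sum_(i < N) \sum_(m < n) (i == k m :> nat)%:R <= _).
    apply: ler_sum => i _.
    have [[m im]|no] := pselect (exists m : 'I_n, i = k m :> nat).
      rewrite [leRHS](bigD1 m)//= {2}im eqxx -[leLHS]addr0 lerD ?sumr_ge0//.
      apply: le_trans (_ : 1 `^ r <= _); last by rewrite powR1.
      by apply: ge0_ler_powR; rewrite ?nnegrE ?rnorm_ge0 ?(ltW r0) ?sum_delta_le1.
    rewrite big1 ?rnorm0 ?powR0 ?gt_eqF ?sumr_ge0// => m _; rewrite /delta ifF//.
    by apply/negP => /eqP im; apply: no; exists m.
  rewrite exchange_big /= -[leRHS]mulr1 mulr_natl -[in leRHS](card_ord n) -sumr_const.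
  apply: ler_sum => m _; have [kN|Nk] := ltnP (k m) N.
    rewrite (bigD1 (Ordinal kN))//= eqxx big1 ?addr0// => i.
    by rewrite -val_eqE /= => /negbTE ->.
  rewrite big1// => i _; rewrite ltn_eqF//.
  exact: leq_trans (ltn_ord i) Nk.
Qed.

Lemma non_spreading_c0 : isomorphic X (c0 X) ->
  exists C J Q, non_spreading (X := X) C J Q.
Proof.
move=> iso; apply: (non_spreading_nspace (ns := c0_ns X)) => //=.
- move=> x x0 i; rewrite -lee_fin fineK; first exact: (le_lp_norm (leey 1)).
  rewrite ge0_fin_numE ?lp_norm_ge0// lp_normyE.
  have [M [_ xM]] := cvg_seq_bounded (cvgP _ x0).
  rewrite (@le_lt_trans _ _ (M + 1)%:E) ?ltry//.
  apply: ge_ereal_sup => _ [n _ <-]; rewrite lee_fin.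
  by rewrite (le_trans (ler_norm _))// xM// ltrDl.
- move=> k x; split.
    apply: cvg_near_cst; exists k.+1 => // i /= ki.
    by rewrite /delta gtn_eqF// rnorm0.
  have fin : (lp_norm +oo (delta k x) <= (rnorm x)%:E)%E.
    apply: lp_normy_le => i; rewrite /delta; case: ifP => // _.
    by rewrite rnorm0 rnorm_ge0.
  rewrite -lee_fin fineK// ge0_fin_numE ?lp_norm_ge0//.
  exact: le_lt_trans fin (ltry _).
- move=> h h0; exists (Num.truncn h^-1).+1 => k x kinj x1.
  have nh : 1 < h * (Num.truncn h^-1).+1%:R.
    by rewrite -ltr_pdivrMl// mulr1 truncnS_gt.
  apply: le_lt_trans nh.
  have fin := lp_normy_le (fun i => sum_delta_le1 (Num.truncn h^-1).+1 i kinj x1).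
  rewrite -lee_fin fineK// ge0_fin_numE ?lp_norm_ge0//.
  exact: le_lt_trans fin (ltry _).
Qed.

End SequenceSpaces.

(** * Norming functionals *)

Section HahnBanach.
Context (R : realType) (s : scalars).
Local Notation K := (scalar_field R s).
Variable X : lmodType K.
Implicit Types (p q f : X -> R).

(** A sublinear functional on the underlying real vector space; the inequality
    for multiples is an equality by [sublinearZ]. *)
Definition sublinear q := (forall x y, q (x + y) <= q x + q y) /\
  (forall a x, 0 <= a -> q (of_real s a *: x) <= a * q x).

Lemma sublinear_ge0 q : sublinear q -> 0 <= q 0.
Proof. by move=> [qD _]; have := qD 0 0; rewrite addr0; lra. Qed.

Lemma sublinear_opp q x : sublinear q -> - q (- x) <= q x.
Proof.
move=> qs; have := qs.1 x (- x); rewrite subrr.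
by have := sublinear_ge0 qs; lra.
Qed.

Lemma sublinearZ q a x : sublinear q -> 0 <= a -> q (of_real s a *: x) = a * q x.
Proof.
move=> qs a0; apply/eqP; rewrite eq_le qs.2//=.
move: a0; rewrite le0r => /predU1P[->|a0].
  by rewrite of_real0 scale0r mul0r sublinear_ge0.
rewrite -ler_pdivlMl//.
have {1}-> : x = of_real s a^-1 *: (of_real s a *: x).
  by rewrite scalerA -of_realM mulVf ?gt_eqF// of_real1 scale1r.
by apply: qs.2; rewrite invr_ge0 ltW.
Qed.

(** Forcing additivity of [q] in the direction [y]. *)
Lemma sublinear_reduction q y : sublinear q -> exists2 q', sublinear q' &
  forall x, q' x <= q x /\ q' x <= q (x + y) - q y.
Proof.
move=> qs; have [qD _] := qs.
pose A x := [set q (x + of_real s a *: y) - a * q y | a in [set a : R | 0 <= a]].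
have A0 x : (A x !=set0)%classic by exists (q (x + of_real s 0 *: y) - 0 * q y), 0 => /=.
have lowA x : has_lbound (A x).
  exists (- q (- x)) => _ [a /= a0 <-].
  have := qD (x + of_real s a *: y) (- x).
  rewrite addrAC subrr add0r sublinearZ//; lra.
have leA x a : 0 <= a -> inf (A x) <= q (x + of_real s a *: y) - a * q y.
  by move=> a0; apply: ge_inf => //; exists a.
have q'q x : inf (A x) <= q x.
  by have := leA x 0 (lexx 0); rewrite of_real0 scale0r addr0 mul0r subr0.
exists (fun x => inf (A x)); first split.
- move=> x x'; rewrite -lerBlDr; apply: lb_le_inf => // _ [a /= a0 <-].
  rewrite lerBlDr [leRHS]addrC -lerBlDr; apply: lb_le_inf => // _ [b /= b0 <-].
  rewrite lerBlDr; apply: le_trans (leA _ (a + b) (addr_ge0 a0 b0)) _.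
  have := qD (x + of_real s a *: y) (x' + of_real s b *: y).
  by rewrite addrACA -scalerDl -of_realD; lra.
- move=> c x; rewrite le0r => /predU1P[->|c0].
    by rewrite (le_trans (q'q _))// sublinearZ// !mul0r.
  rewrite -ler_pdivrMl//; apply: lb_le_inf => // _ [a /= a0 <-].
  rewrite ler_pdivrMl//; apply: le_trans (leA _ (c * a) _) _.
    by rewrite mulr_ge0// ltW.
  rewrite of_realM -scalerA -scalerDr sublinearZ ?(ltW c0)//.
  by rewrite mulrBr mulrA.
- move=> x; split=> //.
  by have := leA x 1 ler01; rewrite of_real1 scale1r mul1r.
Qed.

(** A minimal sublinear functional below [p] exists by Zorn's lemma; it is
    additive by the reduction above. *)
Lemma sublinear_dominates p : sublinear p -> exists f, [/\
  forall x y, f (x + y) = f x + f y,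
  forall a x, f (of_real s a *: x) = a * f x & forall x, f x <= p x].
Proof.
move=> ps; pose D q := sublinear q /\ forall x, q x <= p x; pose T := {q : X -> R | D q}.
pose below (q q' : T) := `[< forall x, sval q' x <= sval q x >].
have [||||[q [qs qp]] qmin] := @Zorn T below.
- by move=> q; apply/asboolP.
- move=> q q' q'' /asboolP h /asboolP h'; apply/asboolP => x.
  exact: le_trans (h' x) (h x).
- move=> [q qP] [q' q'P] /asboolP h /asboolP h'.
  have qq' : q = q' by apply/funext => x; apply/eqP; rewrite eq_le h' h.
  by subst q'; congr exist; exact: Prop_irrelevance.
- move=> A Atot; have [[t0 At0]|noA] := pselect (exists t, A t); last first.
    exists (exist D p (conj ps (fun x => lexx (p x)))) => t At.
    by exfalso; apply: noA; exists t.
  pose B x := [set sval t x | t in A].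
  have B0 x : (B x !=set0)%classic by exists (sval t0 x), t0.
  have lowB x : has_lbound (B x).
    exists (- p (- x)) => _ [t At <-]; have [ts tp] := svalP t.
    by have := sublinear_opp x ts; have := tp (- x); lra.
  have leB x t : A t -> inf (B x) <= sval t x by move=> At; apply: ge_inf => //; exists t.
  have Bs : sublinear (fun x => inf (B x)).
    split=> [x y|a x a0].
      rewrite -lerBlDr; apply: lb_le_inf => // _ [t At <-].
      rewrite lerBlDr [leRHS]addrC -lerBlDr; apply: lb_le_inf => // _ [u Au <-].
      rewrite lerBlDr; have [/asboolP tu|/asboolP ut] := Atot _ _ At Au.
        apply: le_trans (leB _ _ Au) _; have [[uD _] _] := svalP u.
        by apply: le_trans (uD x y) _; rewrite addrC lerD2l.
      apply: le_trans (leB _ _ At) _; have [[tD _] _] := svalP t.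
      by apply: le_trans (tD x y) _; rewrite addrC lerD2r.
    move: a0; rewrite le0r => /predU1P[->|a0].
      apply: le_trans (leB _ _ At0) _; have [ts _] := svalP t0.
      by rewrite sublinearZ// !mul0r.
    rewrite -ler_pdivrMl//; apply: lb_le_inf => // _ [t At <-].
    rewrite ler_pdivrMl//; apply: le_trans (leB _ _ At) _; have [ts _] := svalP t.
    by rewrite sublinearZ// ltW.
  have Bp x : inf (B x) <= p x.
    by apply: le_trans (leB _ _ At0) _; exact: (svalP t0).2.
  by exists (exist D _ (conj Bs Bp)) => t At; apply/asboolP => x /=; exact: leB.
have qD x y : q (x + y) = q x + q y.
  have [q' q's q'q] := sublinear_reduction y qs.
  have q'p z : q' z <= p z by apply: le_trans (q'q z).1 (qp z).
  have qE : q' = q.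
    apply: (congr1 sval (qmin (exist D q' (conj q's q'p)) _)).
    by apply/asboolP => z; exact: (q'q z).1.
  apply/eqP; rewrite eq_le qs.1 /= -lerBrDr.
  by rewrite -{1}qE; exact: (q'q x).2.
have q0 : q 0 = 0 by have := qD 0 0; rewrite addr0; lra.
have qN x : q (- x) = - q x.
  by have := qD x (- x); rewrite subrr q0; lra.
exists q; split=> // a x; have [a0|a0] := leP 0 a; first exact: sublinearZ.
have := @sublinearZ q (- a) x qs; rewrite oppr_ge0 (ltW a0) => /(_ isT).
have -> : of_real s (- a) = - of_real s a :> K.
  by apply/eqP; rewrite -addr_eq0 -of_realD addNr of_real0.
by rewrite scaleNr qN; lra.
Qed.

End HahnBanach.

(** A real-linear functional is the real part of a linear one. *)
Lemma functional_of_real_part (R : realType) (s : scalars)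
    (X : lmodType (scalar_field R s)) (f : X -> R) :
  (forall x y, f (x + y) = f x + f y) ->
  (forall a x, f (of_real s a *: x) = a * f x) ->
  exists2 F : X -> (scalar_field R s)^o, linear F & forall x, real_part (F x) = f x.
Proof.
case: s X f => /= X f fD fZ.
  by exists f => // a x y; rewrite fD fZ.
have f0 : f 0 = 0 by have := fD 0 0; rewrite addr0; lra.
have fN x : f (- x) = - f x by have := fD x (- x); rewrite subrr f0; lra.
exists (fun x => Complex (f x) (- f ((Complex 0 1) *: x))) => // -[a b] x y.
have cE z : Complex a b *: z = real_complex R a *: z + real_complex R b *: (Complex 0 1 *: z) :> X.
  by rewrite scalerA -scalerDl; congr (_ *: _); simpc.
have icE z : Complex 0 1 *: (Complex a b *: z) =
    real_complex R a *: (Complex 0 1 *: z) - real_complex R b *: z :> X.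
  by rewrite !scalerA -scalerBl; congr (_ *: _); simpc.
rewrite scalerDr icE cE !fD fN !fZ; simpc.
by congr Complex; ring.
Qed.

Section Norming.
Context (R : realType) (s : scalars).
Local Notation K := (scalar_field R s).

Lemma real_part_le_rabs (z : K) : real_part z <= rabs z.
Proof.
case: s z => /= z; first exact: ler_norm.
by have := normc_ge_Re z; rewrite lecE => /andP[_]; exact: le_trans (ler_norm _).
Qed.

(** Hahn-Banach: each vector is normed by a functional. *)
Lemma norming_functional (X : normedModType K) (x0 : X) :
  exists2 F : X -> K^o, bounded_by 1 F & real_part (F x0) = rnorm x0.
Proof.
have ns : sublinear (fun x : X => rnorm x).
  by split=> [x y|a x a0]; [exact: ler_rnormD|rewrite rnormZ rabs_of_real].
have [q qs qP] := sublinear_reduction x0 ns.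
have [f [fD fZ fq]] := sublinear_dominates qs.
have fn x : f x <= rnorm x by apply: le_trans (fq x) (qP x).1.
have fx0 : f x0 = rnorm x0.
  apply/eqP; rewrite eq_le fn /=.
  have := le_trans (fq (- x0)) (qP (- x0)).2; rewrite addNr rnorm0.
  have f0 : f 0 = 0 by have := fD 0 0; rewrite addr0; lra.
  by have := fD x0 (- x0); rewrite subrr f0; lra.
have [F lF Ff] := functional_of_real_part fD fZ.
exists F; last by rewrite Ff.
split=> // x; rewrite mul1r.
have [->|Fx0] := eqVneq (F x) 0; first by rewrite rnorm0 rnorm_ge0.
(* rotate [x] so that the value of [F] becomes real *)
pose c : K := `|F x : K| / (F x : K).
have c1 : rabs c = 1.
  apply: (@of_real_inj _ s); rewrite of_real_rabs normf_div normr_id of_real1.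
  by rewrite divff// normr_eq0.
have cF : F (c *: x) = `|F x : K|.
  by rewrite (linear_mapZ lF) [LHS]divfK.
have -> : rnorm (F x) = f (c *: x) by rewrite -Ff cF.
by apply: le_trans (fn _) _; rewrite rnormZ c1 mul1r.
Qed.

End Norming.

(** * Spaces whose dual has finite cotype *)

Section Cotype.
Context (R : realType) (s : scalars).
Local Notation K := (scalar_field R s).

(** The functionals [G m] built from the coordinates of an operator in disjoint
    blocks, by norming functionals of the images of the vectors [x m], have
    uniformly bounded signed sums; finite cotype bounds how many of them can be
    large. *)
Lemma non_spreading_cotype (X : normedModType K) :
  finite_cotype (dual X) -> non_spreading (X := X) 1 (fun=> id) (fun=> id).
Proof.
move=> [q [q2 [C Cq]]]; apply: non_spreadingI => // [k|k|M d d0];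
  try exact: bounded_by_id.
have q0 : 0 < q by rewrite (lt_le_trans _ q2).
pose B := `|C| * `|M|; have B0 : 0 <= B by rewrite mulr_ge0.
(* if [n] functionals of norm at least [d] had signed sums bounded by [|M|],
   cotype [q] would give [n * d ^ q <= B ^ q] *)
pose n := (Num.truncn (B `^ q / d `^ q)).+1.
have nB : B `^ q < n%:R * d `^ q by rewrite -ltr_pdivrMr ?powR_gt0// truncnS_gt.
exists n => t [tlin tM] N F k x Fdisj _ x1 large.
have /choice[phi phiP] (p : nat * nat) : exists f : X -> K^o,
    bounded_by 1 f /\ real_part (f (t p.1 (x p.2))) = rnorm (t p.1 (x p.2)).
  by have [f fb fx] := norming_functional (t p.1 (x p.2)); exists f.
pose g m y : K^o := \sum_(i < N | F m i) phi (i : nat, m) (t i y).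
have g_le m y : rnorm (g m y) <= \sum_(i < N | F m i) rnorm (t i y).
  apply: le_trans (ler_rnorm_sum _ _ _) _; apply: ler_sum => i _.
  by rewrite (le_trans (bounded_byE _ (phiP _).1))// mul1r.
have tM' y : \sum_(i < N) rnorm (t i y) <= `|M| * rnorm y.
  by apply: le_trans (tM y N) _; rewrite ler_wpM2r ?rnorm_ge0 ?ler_norm.
have g_bd m : bounded_by `|M| (g m).
  split=> // [a y z|y].
    rewrite /g scaler_sumr -big_split /=; apply: eq_bigr => i _.
    by rewrite tlin (bounded_by_linear (phiP _).1).
  apply: le_trans (g_le m y) _; apply: le_trans (tM' y).
  by apply: (@ler_sum_all _ (fun i => rnorm (t i y))) => i; exact: rnorm_ge0.
have /choice[G GE] m : exists G : dual X, forall y, (G : operator X K^o) y = g m y.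
  by have [G GE _] := bounded_by_operator (g_bd m); exists G.
have G_large (m : 'I_n) : d <= rnorm (G m).
  apply: le_trans (_ : rnorm (g m (x m)) <= _); last first.
    rewrite -GE (le_trans (bounded_byE _ (operator_bounded_by (G m))))//.
    by rewrite ler_piMr ?rnorm_ge0.
  apply: le_trans (real_part_le_rabs _); apply: le_trans (ltW (large m _)) _ => //.
  have rpD (a b : K) : real_part (a + b) = real_part a + real_part b.
    by case: s a b => //= -[a1 a2] [b1 b2].
  have rp0 : real_part (0 : K) = 0 by case: s.
  rewrite (big_morph (@real_part R s) rpD rp0) /=.
  by apply: ler_sum => i _; rewrite (phiP (i : nat, m : nat)).2.
have G_signs (e : {ffun 'I_n -> bool}) :
    rnorm (\sum_(m < n) (-1) ^+ e m *: G m) <= `|M|.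
  apply: rnorm_operator_le => // y.
  rewrite op_fun_sum (le_trans (ler_rnorm_sum _ _ _))//.
  apply: le_trans (_ : \sum_(m < n) rnorm (g m y) <= _).
    by apply: ler_sum => m _; rewrite op_funZ rnorm_sign GE.
  apply: le_trans (tM' y).
  apply: le_trans (@ler_sum_blocks _ (fun i => rnorm (t i y)) F n N _ Fdisj).
    by apply: ler_sum => m _; exact: g_le.
  by move=> i; exact: rnorm_ge0.
have sq_le : Num.sqrt ((2 ^+ n)^-1 * \sum_(e : {ffun 'I_n -> bool})
    rnorm (\sum_(m < n) (-1) ^+ e m *: G m) ^+ 2) <= `|M|.
  rewrite -[leRHS]normr_id -sqrtr_sqr ler_wsqrtr// ler_pdivrMl ?exprn_gt0//.
  apply: le_trans (_ : \sum_(e : {ffun 'I_n -> bool}) `|M| ^+ 2 <= _).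
    apply: ler_sum => e _; rewrite lerXn2r ?nnegrE ?rnorm_ge0//.
  by rewrite sumr_const -[leLHS]mulr_natl card_signs.
have := Cq n (fun m => G m); apply/negP; rewrite -ltNge.
apply: le_lt_trans (_ : B < _).
  rewrite (le_trans (ler_wpM2r _ (ler_norm C))) ?sqrtr_ge0// ler_wpM2l//.
have -> : B = (B `^ q) `^ q^-1 by rewrite -powRrM mulfV ?gt_eqF// powRr1.
apply: gt0_ltr_powR; rewrite ?invr_gt0 ?nnegrE ?powR_ge0//.
  by rewrite sumr_ge0// => m _; exact: powR_ge0.
apply: lt_le_trans nB _; rewrite mulr_natl -[n in _ *+ n](card_ord n) -sumr_const.
apply: ler_sum => m _.
by apply: ge0_ler_powR; rewrite ?nnegrE ?rnorm_ge0 ?(ltW q0) ?(ltW d0).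
Qed.

End Cotype.

Theorem theorem1p1 (R : realType) (s : scalars)
    (X : completeNormedModType (scalar_field R s)) :
  UPFP X ->
  ((exists (p : \bar R) (p1 : (1 <= p)%E), isomorphic X (ell X p1)) \/
     isomorphic X (c0 X)) \/
  finite_cotype (dual X) ->
  UPFP (ell1 X) /\ primary (ell1 X).
Proof.
move=> Xpfp hX; suff ell1_pfp : UPFP (ell1 X).
  by split=> //; exact: UPFP_ell1_primary.
have of_ns : (exists C J Q, @non_spreading R s X C J Q) -> UPFP (ell1 X).
  move=> [C [J [Q JQ]]]; apply: (UPFP_ell1_of_non_spreading _ JQ) => //.
  exact: complete_geometrically_complete.
case: hX => [[[p [p1 iso]]|iso]|cot].
- move: (p1); rewrite le_eqVlt => /predU1P[p1E|p_gt1]; last first.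
    exact/of_ns/(non_spreading_ell p_gt1 iso).
  subst p; apply: UPFP_isomorphic Xpfp.
  by rewrite (bool_irrelevance p1 (lexx 1%E)) in iso.
- exact/of_ns/non_spreading_c0.
- apply: of_ns; exists 1, (fun=> id), (fun=> id).
  exact: non_spreading_cotype.
Qed.
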